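(* Let $n\ge 1$, let $V_{\mathbb R}$ be a real vector space of dimension $4n$, and let $\Gamma\subset V_{\mathbb R}$ be a lattice (of rank $4n$). (1) For any twistor line $S\subset Compl$ of type $\mathbb H(-1)$ one has $\dim Hdg_S=2n^2+n$, and $Hdg_S$ does not contain any Kähler classes. All representations $\mathbb H(-1)\to \mathrm{End}\,V_{\mathbb R}$ are equivalent, or, which is the same, the adjoint action of $GL(V_{\mathbb R})$ on the set of twistor lines of type $\mathbb H(-1)$ in $Compl$ is transitive. (2) For any twistor line $S\subset Compl$ of type $\mathbb H(1)$ one has $\dim Hdg_S=2n^2+n$. The subspace $Hdg_S$ contains two disjoint (nonempty) open cones of Kähler classes, one corresponding to each of the two connected components of $S$: every element of the cone corresponding to a connected component of $S$ is a Kähler class with respect to every $\lambda$ in that component. All faithful representations $\mathbb H(1)\to \mathrm{End}\,V_{\mathbb R}$ are equivalent, or, which is the same, the action of $GL(V_{\mathbb R})$ on the set of twistor lines of type $\mathbb H(1)$ in $Compl$ is transitive. (3) There are exactly $n$ pairwise non-equivalent faithful representations $\mathbb H(0)\to \mathrm{End}\,V_{\mathbb R}$, parametrized by integers $1\le k\le n$; equivalently, there are exactly $n$ distinct $GL(V_{\mathbb R})$-orbits of twistor lines of type $\mathbb H(0)$ in $Compl$. For any twistor line $S$ of type $\mathbb H(0)$ one has $\dim Hdg_S=k(k+1)+(2n-k)^2$ for the respective parameter $k$, and $Hdg_S$ does not contain any Kähler classes for either of the two connected components of $S$.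
   Context: $Compl=\{I\in\mathrm{End}\,V_{\mathbb R}\mid I^2=-Id\}$ is the period domain of complex tori $V_{\mathbb R}/\Gamma$ of complex dimension $2n$; $\lambda\in Compl$ corresponds to the complex torus $(V_{\mathbb R}/\Gamma,\lambda)$. For $\varepsilon\in\{-1,0,1\}$, $\mathbb H(\varepsilon)=\langle i,j\mid i^2=-1,\ j^2=\varepsilon,\ ij+ji=0\rangle$ is the corresponding $4$-dimensional real (unital, associative) algebra. Representations $\mathbb H(\varepsilon)\to\mathrm{End}\,V_{\mathbb R}$ are unital algebra homomorphisms, and two are equivalent if they are conjugate by an element of $GL(V_{\mathbb R})$. An imaginary unit is an element with square $-1$. A (generalized) twistor line of type $\mathbb H(\varepsilon)$ is the image in $Compl$ of the set of imaginary units of $\mathbb H(\varepsilon)$ under a faithful representation $\mathbb H(\varepsilon)\to \mathrm{End}\,V_{\mathbb R}$. Twistor lines of type $\mathbb H(-1)$ are $2$-spheres; those of type $\mathbb H(0)$ and $\mathbb H(1)$ are noncompact and have two connected components, interchanged by $\lambda\mapsto-\lambda$. The group $GL(V_{\mathbb R})$ acts on $Compl$ and on the set of twistor lines by the adjoint action $g\cdot I=gIg^{-1}$. The parameter $k$ of a faithful representation of $\mathbb H(0)$ (and of the resulting twistor line) is defined by $\mathrm{rank}\,N=2k$, where $N\in\mathrm{End}\,V_{\mathbb R}$ is the image of $j$. For a twistor line $S$, $Hdg_S=\{\Omega\in\mathrm{Hom}(\wedge^2V_{\mathbb R},\mathbb R)\mid \Omega(\lambda u,\lambda v)=\Omega(u,v)\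 \forall\lambda\in S,\ u,v\in V_{\mathbb R}\}$, the space of alternating real forms defining classes in $H^{1,1}((V_{\mathbb R}/\Gamma,\lambda),\mathbb R)$ for all $\lambda\in S$. A $\lambda$-invariant alternating form $\Omega$ is a Kähler class with respect to $\lambda\in Compl$ (i.e. on $(V_{\mathbb R}/\Gamma,\lambda)$) if $\Omega(u,\lambda u)>0$ for all nonzero $u\in V_{\mathbb R}$. ''$Hdg_S$ does not contain any Kähler classes'' means that no $\Omega\in Hdg_S$ is a Kähler class with respect to any $\lambda\in S$. An open cone in $Hdg_S$ is an open subset of the vector space $Hdg_S$ closed under multiplication by positive reals. *)

(* Defs.v *)
From HB Require Import structures.
From mathcomp Require Import all_boot all_order all_algebra.
From mathcomp Require Import ring.
From mathcomp Require Import all_classical all_reals all_analysis.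

Set Implicit Arguments.
Unset Strict Implicit.
Unset Printing Implicit Defensive.

Import Order.TTheory GRing.Theory Num.Theory.
Import numFieldNormedType.Exports.

Local Open Scope classical_set_scope.
Local Open Scope ring_scope.

(* H(eps): Quat a b c d stands for a + b i + c j + d ij, and the product
   below is forced by i^2 = -1, j^2 = eps and ij + ji = 0. *)
Record quat (R : comNzRingType) (eps : R) : Type := Quat {
  quat_re : R; quat_im : R; quat_jm : R; quat_km : R }.

Section QuatAlgebra.
Variables (R : comNzRingType) (eps : R).
Local Notation H := (quat eps).
Local Notation Q := (@Quat R eps).

Definition quat_coords (x : H) :=
  (quat_re x, quat_im x, quat_jm x, quat_km x).
Definition coords_quat (t : R * R * R * R) : H :=
  let: (a, b, c, d) := t in Q a b c d.
Fact quat_coordsK : cancel quat_coords coords_quat. Proof. by case. Qed.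

HB.instance Definition _ := Choice.copy H (can_type quat_coordsK).

Definition quat_zero : H := Q 0 0 0 0.
Definition quat_opp (x : H) : H :=
  let: Quat a b c d := x in Q (- a) (- b) (- c) (- d).
Definition quat_add (x y : H) : H :=
  let: Quat a b c d := x in let: Quat a' b' c' d' := y in
  Q (a + a') (b + b') (c + c') (d + d').
Definition quat_scale (t : R) (x : H) : H :=
  let: Quat a b c d := x in Q (t * a) (t * b) (t * c) (t * d).
Definition quat_one : H := Q 1 0 0 0.
Definition quat_mul (x y : H) : H :=
  let: Quat a b c d := x in let: Quat a' b' c' d' := y in
  Q (a * a' - b * b' + eps * (c * c') + eps * (d * d'))
    (a * b' + b * a' - eps * (c * d') + eps * (d * c'))
    (a * c' + c * a' - b * d' + d * b')
    (a * d' + d * a' + b * c' - c * b').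

Fact quat_addA : associative quat_add.
Proof. by move=> [????] [????] [????] /=; congr Quat; ring. Qed.
Fact quat_addC : commutative quat_add.
Proof. by move=> [????] [????] /=; congr Quat; ring. Qed.
Fact quat_add0 : left_id quat_zero quat_add.
Proof. by move=> [????] /=; congr Quat; ring. Qed.
Fact quat_addN : left_inverse quat_zero quat_opp quat_add.
Proof. by move=> [????] /=; congr Quat; ring. Qed.
HB.instance Definition _ :=
  GRing.isZmodule.Build H quat_addA quat_addC quat_add0 quat_addN.

Fact quat_mulA : associative quat_mul.
Proof. by move=> [????] [????] [????] /=; congr Quat; ring. Qed.
Fact quat_mul1l : left_id quat_one quat_mul.
Proof. by move=> [????] /=; congr Quat; ring. Qed.
Fact quat_mul1r : right_id quat_one quat_mul.
Proof. by move=> [????] /=; congr Quat; ring. Qed.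
Fact quat_mulDl : left_distributive quat_mul quat_add.
Proof. by move=> [????] [????] [????] /=; congr Quat; ring. Qed.
Fact quat_mulDr : right_distributive quat_mul quat_add.
Proof. by move=> [????] [????] [????] /=; congr Quat; ring. Qed.
Fact quat_one_neq0 : quat_one != 0.
Proof. by apply/eqP => -[] /eqP; rewrite oner_eq0. Qed.
HB.instance Definition _ := GRing.Zmodule_isNzRing.Build H
  quat_mulA quat_mul1l quat_mul1r quat_mulDl quat_mulDr quat_one_neq0.

Fact quat_scaleA s t (x : H) :
  quat_scale s (quat_scale t x) = quat_scale (s * t) x.
Proof. by case: x => * /=; congr Quat; ring. Qed.
Fact quat_scale1 : left_id 1 quat_scale.
Proof. by move=> [????] /=; congr Quat; ring. Qed.
Fact quat_scaleDr : right_distributive quat_scale +%R.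
Proof. by move=> ? [????] [????]; congr Quat; ring. Qed.
Fact quat_scaleDl x : {morph quat_scale^~ x : s t / s + t}.
Proof. by case: x => * s t; congr Quat; ring. Qed.
HB.instance Definition _ := GRing.Zmodule_isLmodule.Build R H
  quat_scaleA quat_scale1 quat_scaleDr quat_scaleDl.

Fact quat_scaleAl (k : R) (x y : H) : k *: (x * y) = (k *: x) * y.
Proof. by case: x y => [????] [????]; congr Quat; ring. Qed.
HB.instance Definition _ := GRing.Lmodule_isLalgebra.Build R H quat_scaleAl.

Fact quat_scaleAr (k : R) (x y : H) : k *: (x * y) = x * (k *: y).
Proof. by case: x y => [????] [????]; congr Quat; ring. Qed.
HB.instance Definition _ := GRing.Lalgebra_isAlgebra.Build R H quat_scaleAr.

Definition quat_i : H := Q 0 1 0 0.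
Definition quat_j : H := Q 0 0 1 0.

Lemma quat_i2 : quat_i * quat_i = -1.
Proof. by congr Quat; ring. Qed.
Lemma quat_j2 : quat_j * quat_j = eps%:A.
Proof. by congr Quat; ring. Qed.
Lemma quat_ij : quat_i * quat_j + quat_j * quat_i = 0.
Proof. by congr Quat; ring. Qed.
Lemma quat_basisE (a b c d : R) :
  Q a b c d = a%:A + b *: quat_i + c *: quat_j + d *: (quat_i * quat_j).
Proof. by congr Quat; ring. Qed.

Definition imaginary_units : set H := [set x | x * x = -1].

End QuatAlgebra.

Arguments quat_i {R eps}.
Arguments quat_j {R eps}.
Arguments imaginary_units {R} eps _.

Section VectorTopology.
Variables (R : realType) (W : vectType R).

(* The standard topology of a finite-dimensional real vector space, pulled
   back from R^(dim W) along a linear coordinate isomorphism. *)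
Definition vtop : topologicalType :=
  initial_topology (VectorInternalTheory.v2r : W -> 'rV[R]_(dim W)).

Definition components (A : set W) : set (set W) :=
  [set (connected_component (A : set vtop) x : set W) | x in A].

Definition relatively_open (A C : set W) : Prop :=
  exists2 U : set W, open (U : set vtop) & C = A `&` U.

Definition open_cone_in (A C : set W) : Prop :=
  relatively_open A C /\
  forall (t : R) (w : W), 0 < t -> C w -> C (t *: w).

(* A is a linear subspace of W of dimension d. *)
Definition has_dim (A : set W) (d : nat) : Prop :=
  exists2 U : {vspace W}, A = [set w | w \in U] & \dim U = d.

(* The Z-span of a basis of W. *)
Definition lattice (Gamma : set W) : Prop :=
  exists2 b : (\dim {:W}).-tuple W,
    basis_of fullv b & Gamma = [set w | inIntSpan b w].

End VectorTopology.

Section Twistor.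
Variables (R : realType) (V : vectType R).
Local Open Scope lfun_scope.

Definition Compl : set 'End(V) := [set I | I \o I = - \1].

(* In the library g^-1 is only a right inverse of g on the image of g, hence
   the two conditions. *)
Definition GL : set 'End(V) := [set g | g \o g^-1 = \1 /\ g^-1 \o g = \1].

Definition adj (g I : 'End(V)) : 'End(V) := g \o I \o g^-1.

Definition adjoint_orbit (S : set 'End(V)) : set (set 'End(V)) :=
  [set adj g @` S | g in GL].

Section Representations.
Variable eps : R.
Implicit Types rho : quat eps -> 'End(V).

Definition representation rho : Prop :=
  [/\ linear rho, rho 1 = \1 & forall x y, rho (x * y)%R = rho x \o rho y].

Definition faithful_representation rho : Prop :=
  representation rho /\ injective rho.

Definition rep_equiv rho rho' : Prop :=
  exists2 g, GL g & forall x, rho' x = adj g (rho x).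

Definition rep_class rho : set (quat eps -> 'End(V)) :=
  [set rho' | representation rho' /\ rep_equiv rho rho'].

Definition twistor_of rho : set 'End(V) := rho @` imaginary_units eps.

Definition twistor_line (S : set 'End(V)) : Prop :=
  exists2 rho, faithful_representation rho & S = twistor_of rho.

Lemma twistor_line_Compl S : twistor_line S -> S `<=` Compl.
Proof.
move=> [rho [[lin_rho rho1 rhoM] _] ->] _ [x xx <-]; rewrite /Compl /=.
have xx' : x * x = -1 := xx.
pose f : {linear quat eps -> 'End(V)} :=
  HB.pack rho (GRing.isLinear.Build _ _ _ _ rho lin_rho).
have fN : rho (-1) = - rho 1 := raddfN f 1.
by rewrite -rhoM xx' fN rho1.
Qed.

(* One orbit exactly: transitivity includes nonemptiness. *)
Definition GL_transitive_on_twistor_lines : Prop :=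
  (exists S, twistor_line S) /\
  forall S S', twistor_line S -> twistor_line S' -> adjoint_orbit S S'.

End Representations.

(* The parameter k, given by rank N = 2k with N the image of j. *)
Definition rep_param (rho : quat (0 : R) -> 'End(V)) (k : nat) : Prop :=
  \dim (limg (rho quat_j)) = (2 * k)%N.

Definition twistor_param (S : set 'End(V)) (k : nat) : Prop :=
  exists2 rho, faithful_representation rho &
    S = twistor_of rho /\ rep_param rho k.

(* A bilinear form Om is curried: its value on (u, v) is Om u v. *)
Definition bilin : vectType R := 'Hom(V, 'Hom(V, R^o)).
Implicit Type Om : bilin.

Definition form_val Om (u v : V) : R := (Om : 'Hom(V, 'Hom(V, R^o))) u v.

Definition alternating Om : Prop := forall u, form_val Om u u = 0.

Definition lam_invariant (lam : 'End(V)) Om : Prop :=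
  forall u v, form_val Om (lam u) (lam v) = form_val Om u v.

Definition Hdg (S : set 'End(V)) : set bilin :=
  [set Om | alternating Om /\ forall lam, S lam -> lam_invariant lam Om].

Definition kahler (lam : 'End(V)) Om : Prop :=
  [/\ Compl lam, alternating Om, lam_invariant lam Om &
      forall u, u != 0 -> 0 < form_val Om u (lam u)].

Definition no_kahler (S : set 'End(V)) : Prop :=
  forall Om lam, Hdg S Om -> S lam -> ~ kahler lam Om.

Definition kahler_cone (S T : set 'End(V)) (C : set bilin) : Prop :=
  [/\ C !=set0, open_cone_in (Hdg S) C &
      forall Om lam, C Om -> T lam -> kahler lam Om].

End Twistor.

Arguments GL_transitive_on_twistor_lines {R} V eps.

(* Main.v *)
Require Import Defs.
From HB Require Import structures.
From mathcomp Require Import all_boot all_order all_algebra.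
From mathcomp Require Import zify ring lra.
From mathcomp Require Import all_classical all_reals all_analysis.

Set Implicit Arguments.
Unset Strict Implicit.
Unset Printing Implicit Defensive.

Import Order.TTheory GRing.Theory Num.Theory.
Import numFieldNormedType.Exports.

Local Open Scope classical_set_scope.
Local Open Scope card_scope.
Local Open Scope ring_scope.

(** A representation of H(eps) makes V an H(eps)-module, and every assertion
   is read off a normal form of that module: V is the direct sum of p copies
   of H(eps) and q copies of H(eps)/H(eps)j, with q = 0 unless eps = 0.  A
   [frame] records generators of such a decomposition and the coordinates
   with respect to them.

   Existence of frames.  Generators are added one at a time, as long as they
   do not span ([act_greedy]); what has to be shown in each case is that a
   new generator can be chosen independent of the previous ones.
   - H(-1) is a division algebra, so any vector outside a submodule will do
     ([division_frame]).
   - H(1) is the algebra of real 2 x 2 matrices, and f1 + i f2 generates a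
     free module when f1 and f2 are independent vectors fixed by j
     ([split_frame]).
   - For eps = 0 the images of i and j make the kernel and the image of j
     complex subspaces.  Preimages under j of a complex basis of the image
     are the free generators, and completing that basis to one of the kernel
     gives the others ([dual_frame]).  Here p is half the rank of j
     ([frame_rank]).

   Classification.  Representations with frames of the same shape (p, q) are
   equivalent ([frame_rep_equiv]), and each shape with 4p + 2q = dim V, where
   q = 0 unless eps = 0, is realized ([frame_ex]).  This leaves a
   single class for eps = -1, a single class for eps = 1, and for eps = 0 one
   class for each k = p between 1 and n.  A twistor line of type H(0) determines k: the image of j is a
   difference of two of its points, and the only such differences of square
   zero are the images of multiples of j ([twistor_rank_le]).

   Dimension.  A twistor line contains the images of i and of some b i + j,
   so its Hodge forms are the alternating forms for which every x is adjoint
   to its conjugate ([HdgP]).  Such a form is determined by its values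
   Om(e_s, x e_t) on generators, that is, by four real matrices, the
   coefficients of 1, i, j and ij in x.  The first is skew, the others are
   symmetric, and the last two are supported on free generators.  A skew and
   a symmetric matrix of size p + q amount to an arbitrary matrix, and two
   symmetric matrices of size p to p (p + 1) numbers, so the dimension is
   (p + q)^2 + p (p + 1) ([frame_has_dim_Hdg]).

   Kaehler classes.  For eps = -1, k = ij and a pure quaternion x one has
   x - i x i - j x j - k x k = 0, so Om(v, x v) cannot be positive at all of
   u, i u, j u, k u.  For eps = 0 one has j x j = 0, so Om(j u, x j u) = 0.
   For eps = 1 a Hodge form for which Om(u, i u) is positive definite is
   Kaehler for every x in the component of i, because x is conjugate to i by
   z = 1 - x i, of positive norm ([split_sheet_kahler]).  The forms whose
   Gram matrix in the basis given by a frame is diagonally dominant make up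
   an open cone of such forms ([cone_open], [cone_nonempty]).

   Components.  For eps >= 0 the coordinate of i does not vanish on a twistor
   line, and each of the two sheets cut out by its sign is connected
   ([components_twistor]). *)

(** * Linear maps between finite-dimensional spaces *)
Section LinearMaps.
Variable K : fieldType.
Implicit Types U W : vectType K.
Import VectorInternalTheory.

Lemma lfun_ex U W (f : U -> W) : linear f -> {F : 'Hom(U, W) | F =1 f}.
Proof.
move=> lin_f.
pose g : {linear U -> W} := HB.pack f (GRing.isLinear.Build _ _ _ _ f lin_f).
by exists (linfun g) => u; rewrite lfunE.
Qed.

Lemma linear_iso_ex U W : \dim {:U} = \dim {:W} ->
  exists (f : 'Hom(U, W)) (g : 'Hom(W, U)), cancel f g /\ cancel g f.
Proof.
rewrite !dimvf => dUW.
have cast_linear m m' (eq_m : m = m') :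
    linear (castmx (erefl 1%N, eq_m) : 'rV[K]_m -> 'rV[K]_m').
  by case: m' / eq_m => a x y; rewrite !castmx_id.
have [f fE] : {f : 'Hom(U, W) |
    f =1 fun u => r2v (castmx (erefl 1%N, dUW) (v2r u))}.
  by apply: lfun_ex => a u v; rewrite linearP cast_linear linearP.
have [g gE] : {g : 'Hom(W, U) |
    g =1 fun u => r2v (castmx (erefl 1%N, esym dUW) (v2r u))}.
  by apply: lfun_ex => a u v; rewrite linearP cast_linear linearP.
by exists f, g; split=> u; rewrite fE gE r2vK castmx_comp castmx_id v2rK.
Qed.

End LinearMaps.

Section HasDim.
Variables (R : realType) (U W : vectType R).

(** The form in which dimensions are computed below: by an explicit linear
   parametrization of the subspace. *)
Lemma has_dim_param (f : U -> W) (A : set W) :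
  linear f -> injective f -> A = range f -> has_dim A (\dim {:U}).
Proof.
move=> lin_f inj_f ->; have [F FE] := lfun_ex lin_f.
exists (limg F); last first.
  apply: limg_dim_eq; apply/eqP; rewrite capfv -subv0; apply/subvP => u.
  rewrite memv_ker memv0 => /eqP Fu0; apply/eqP/inj_f.
  by rewrite -!FE Fu0 linear0.
apply/seteqP; split=> w /=.
  by case=> u _ <-; rewrite -FE memv_img ?memvf.
by case/memv_imgP => u _ ->; exists u => //; rewrite FE.
Qed.

End HasDim.

(** * Growing a family of generators *)
Section Greedy.
Variables (K : fieldType) (A V : vectType K) (act : A -> 'End(V)).
Hypothesis act_linear : linear act.

(** Only the linear structure of the coefficients is used, so that the same
   construction serves for quaternions and for complex numbers. *)
Definition acomb q (f : 'I_q -> V) (x : {ffun 'I_q -> A}) : V :=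
  \sum_b act (x b) (f b).

Lemma acomb_linear q (f : 'I_q -> V) : linear (acomb f).
Proof.
move=> a x y; rewrite /acomb scaler_sumr -big_split /=.
apply: eq_bigr => b _; rewrite !ffunE /= act_linear.
by rewrite add_lfunE scale_lfunE.
Qed.

Lemma dim_ffun (T : finType) : \dim {: {ffun T -> A}} = (#|T| * \dim {:A})%N.
Proof. by rewrite !dimvf. Qed.

(** A family of q generators that is independent modulo [D0] spans, together
   with [D0], a subspace of dimension [\dim D0 + q * \dim A]; so independent
   families have bounded length, and one that cannot be lengthened spans [X].
   The dimension is handed to the hypothesis that provides new generators
   because for 2 x 2 matrices the new generator is found by counting. *)
Lemma act_greedy (D0 X : {vspace V}) : (0 < \dim {:A})%N -> (D0 <= X)%VS ->
    (forall x u, u \in X -> act x u \in X) ->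
    (forall q (f : 'I_q -> V) (D : {vspace V}), (forall b, f b \in X) ->
       (forall u, u \in D <->
          exists2 d, d \in D0 & exists x, u = d + acomb f x) ->
       (D <= X)%VS -> \dim D = (\dim D0 + q * \dim {:A})%N -> D != X ->
       exists2 v, v \in X & forall x, act x v \in D -> x = 0) ->
  exists q (f : 'I_q -> V), [/\ forall b, f b \in X,
    forall x, acomb f x \in D0 -> x = 0,
    forall u, u \in X -> exists2 d, d \in D0 & exists x, u = d + acomb f x &
    \dim X = (\dim D0 + q * \dim {:A})%N].
Proof.
move=> dA D0X actX step.
pose good q := exists f : 'I_q -> V, (forall b, f b \in X) /\
  (forall x, acomb f x \in D0 -> x = 0).
have good_image q (f : 'I_q -> V) : (forall b, f b \in X) ->
    (forall x, acomb f x \in D0 -> x = 0) ->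
  exists2 D : {vspace V},
    forall u, u \in D <-> exists2 d, d \in D0 & exists x, u = d + acomb f x &
    (D <= X)%VS /\ \dim D = (\dim D0 + q * \dim {:A})%N.
  move=> fX free_f; have [F FE] := lfun_ex (@acomb_linear q f).
  (* The subspace generated by [D0] and the family. *)
  exists (D0 + limg F)%VS.
    move=> u; split=> [/memv_addP|].
      case=> d dD0 [_ /memv_imgP[x _ ->] ->]; exists d => //.
      by exists x; rewrite FE.
    case=> d dD0 [x ->]; apply/memv_addP; exists d => //; exists (F x); last by rewrite FE.
    by rewrite memv_img ?memvf.
  split.
    rewrite subv_add D0X /=; apply/subvP => _ /memv_imgP[x _ ->].
    by rewrite FE; apply: memv_suml => b _; apply: actX.
  rewrite dimv_disjoint_sum; last first.
    apply/eqP; rewrite -subv0; apply/subvP => u.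
    rewrite memv_cap memv0 => /andP[uD0 /memv_imgP[x _ uE]].
    move: uD0; rewrite uE FE => /free_f ->.
    by rewrite -FE linear0.
  rewrite limg_dim_eq ?dim_ffun ?card_ord //.
  apply/eqP; rewrite capfv -subv0; apply/subvP => x.
  rewrite memv_ker memv0 FE => /eqP x0; apply/eqP/free_f.
  by rewrite x0 mem0v.
have good0 : good 0%N.
  exists (fun=> 0); split=> [b|x _]; first by rewrite mem0v.
  by apply/ffunP => -[].
have good_bound q : good q -> (q <= \dim {:V})%N.
  case=> f [fX free_f]; have [D _ [_ dD]] := good_image q f fX free_f.
  apply: leq_trans (dimvS (subvf D)); rewrite dD.
  by apply: leq_trans (leq_addl _ _); rewrite leq_pmulr.
have [q [gq maxq]] : exists q, good q /\ ~ good q.+1.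
  apply: contrapT => no_max.
  have all_good q : good q.
    elim: q => // q IH; apply: contrapT => nq; apply: no_max.
    by exists q.
  by have := good_bound _ (all_good (\dim {:V}).+1); rewrite ltnn.
case: gq => f [fX free_f]; have [D DP [DX dD]] := good_image q f fX free_f.
have [DeX|DneX] := eqVneq D X.
  exists q, f; split=> // [u|]; last by rewrite -dD DeX.
  by rewrite -DeX => /DP.
have [v vX vD] := step q f D fX DP DX dD DneX.
(* The vector [v] would lengthen the family. *)
case: maxq; exists (fun b => if unlift ord0 b is Some c then f c else v).
split=> [b|x]; first by case: unliftP => [c _|_].
rewrite /acomb big_ord_recl unlift_none.
under eq_bigr do rewrite liftK.
pose y := [ffun b => x (lift ord0 b)] : {ffun 'I_q -> A}.
have -> : \sum_(b < q) act (x (lift ord0 b)) (f b) = acomb f y.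
  by apply: eq_bigr => b _; rewrite ffunE.
move=> xD0; have x0 : x ord0 = 0.
  apply: vD; rewrite -[act _ _](addrK (acomb f y)).
  apply/DP; exists (act (x ord0) v + acomb f y) => //.
  exists (- y); have [F FE] := lfun_ex (@acomb_linear q f).
  by rewrite -!FE linearN.
have y0 : y = 0.
  apply: free_f; move: xD0; rewrite x0.
  have act0 : act 0 = 0.
    by have := act_linear (-1) 0 0; rewrite !scaleN1r !addNr.
  by rewrite act0 lfunE /= add0r.
apply/ffunP => b; rewrite ffunE; case: (unliftP ord0 b) => [c ->|-> //].
by have /ffunP/(_ c) := y0; rewrite !ffunE.
Qed.

End Greedy.

(** * Conjugation and norm on H(eps) *)
Section QuatVector.
Variables (R : comNzRingType) (eps : R).
Local Notation H := (quat eps).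

Definition quat_coef (x : H) (l : 'I_4) : R :=
  [:: quat_re x; quat_im x; quat_jm x; quat_km x]`_l.

Definition quat_basis (l : 'I_4) : H :=
  Quat eps (l == 0)%:R (l == 1)%:R (l == 2)%:R (l == 3)%:R.

Fact quat_vect_iso : Vector.axiom 4 H.
Proof.
exists (fun x : H => \row_l quat_coef x l).
  by move=> a [????] [????]; apply/rowP => l; rewrite !mxE; case: l => -[|[|[|[|]]]].
exists (fun v : 'rV[R]_4 => Quat eps (v 0 0) (v 0 1) (v 0 2) (v 0 3)).
  by case=> a b c d; rewrite !mxE.
by move=> v; apply/rowP => -[[|[|[|[|//]]]] lt_l4]; rewrite mxE /=;
  congr (v 0 _); apply/val_inj.
Qed.

HB.instance Definition _ := Lmodule_hasFinDim.Build R H quat_vect_iso.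

Lemma quat_coefE (x : H) : x = \sum_l quat_coef x l *: quat_basis l.
Proof.
case: x => *; rewrite !big_ord_recl big_ord0 /quat_basis /quat_coef.
by congr Quat; rewrite !eqE /=; ring.
Qed.

Definition quat_conj (x : H) : H :=
  Quat eps (quat_re x) (- quat_im x) (- quat_jm x) (- quat_km x).

Definition quat_norm (x : H) : R :=
  quat_re x ^+ 2 + quat_im x ^+ 2
  - eps * quat_jm x ^+ 2 - eps * quat_km x ^+ 2.

Lemma quat_conj_linear : linear quat_conj.
Proof. by move=> k [????] [????]; congr Quat => /=; ring. Qed.

Lemma quat_conjK : involutive quat_conj.
Proof. by case=> *; congr Quat => /=; rewrite opprK. Qed.

Lemma quat_conjM x y : quat_conj (x * y) = quat_conj y * quat_conj x.
Proof. by case: x y => [????] [????]; congr Quat => /=; ring. Qed.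

Lemma quat_mulcJ x : x * quat_conj x = (quat_norm x)%:A.
Proof. by case: x => *; rewrite /quat_norm; congr Quat => /=; ring. Qed.

Lemma quat_mulJc x : quat_conj x * x = (quat_norm x)%:A.
Proof. by case: x => *; rewrite /quat_norm; congr Quat => /=; ring. Qed.

End QuatVector.

(** * Representations, and conjugation by invertible maps *)
Section Representations.
Variables (R : realType) (V : vectType R) (eps : R).
Local Notation H := (quat eps).
Variable rho : H -> 'End(V).
Hypothesis rep : representation rho.

Lemma rep_linear : linear rho. Proof. by case: rep. Qed.

Lemma rep1 v : rho 1 v = v.
Proof. by case: rep => _ -> _; rewrite lfunE. Qed.

Lemma repM x y v : rho (x * y) v = rho x (rho y v).
Proof. by case: rep => _ _ ->; rewrite lfunE. Qed.

Lemma repDZ a x y v : rho (a *: x + y) v = a *: rho x v + rho y v.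
Proof. by rewrite rep_linear !lfunE /= lfunE. Qed.

Lemma rep0 v : rho 0 v = 0.
Proof. by have := repDZ (-1) 0 0 v; rewrite !scaleN1r !addNr. Qed.

Lemma repD x y v : rho (x + y) v = rho x v + rho y v.
Proof. by rewrite -[x]scale1r repDZ !scale1r. Qed.

Lemma repZ a x v : rho (a *: x) v = a *: rho x v.
Proof. by rewrite -[a *: x]addr0 repDZ rep0 addr0. Qed.

Lemma repN x v : rho (- x) v = - rho x v.
Proof. by have := repZ (-1) x v; rewrite !scaleN1r. Qed.

Lemma rep_sum (I : finType) (x : I -> H) v :
  rho (\sum_i x i) v = \sum_i rho (x i) v.
Proof.
by elim/big_rec2: _ => [|i u y _ <-]; rewrite ?rep0 ?repD.
Qed.

End Representations.

Section GL.
Variables (R : realType) (V : vectType R).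
Implicit Types g h : 'End(V).

(** The inverse of a linear map is in general only a section of it on its
   image; this identifies it with any genuine two-sided inverse. *)
Lemma GL_cancel g h : cancel g h -> cancel h g -> GL g /\ g^-1%VF = h.
Proof.
move=> gK hK; have ker0 : lker g == 0%VS.
  by apply/lker0P => u v /(congr1 h); rewrite !gK.
have gV : g^-1%VF = h.
  by apply/lfunP => u; rewrite -{1}[u]hK lker0_lfunK.
by split=> //; split; apply/lfunP => u; rewrite !lfunE /= gV ?hK ?gK.
Qed.

Lemma GLK g : GL g -> cancel g g^-1%VF.
Proof. by case=> _ /lfunP gV u; have := gV u; rewrite !lfunE. Qed.

Lemma GLVK g : GL g -> cancel g^-1%VF g.
Proof. by case=> /lfunP gV _ u; have := gV u; rewrite !lfunE. Qed.

Lemma GL_inv g : GL g -> GL g^-1%VF.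
Proof. by move=> Gg; case: (GL_cancel (GLVK Gg) (GLK Gg)). Qed.

Lemma GL1 : GL (\1%VF : 'End(V)).
Proof. by case: (@GL_cancel \1%VF \1%VF) => // u; rewrite !lfunE. Qed.

Lemma GL_comp g h : GL g -> GL h ->
  GL (g \o h)%VF /\ (g \o h)^-1%VF = (h^-1 \o g^-1)%VF.
Proof.
move=> Gg Gh; apply: GL_cancel => u; rewrite !comp_lfunE.
  by rewrite (GLK Gg) (GLK Gh).
by rewrite (GLVK Gh) (GLVK Gg).
Qed.

Lemma adjE g I v : adj g I v = g (I (g^-1%VF v)).
Proof. by rewrite /adj !comp_lfunE. Qed.

Lemma adj1 (I : 'End(V)) : adj (\1%VF : 'End(V)) I = I.
Proof.
have [_ oneV] : GL (\1%VF : 'End(V)) /\ (\1%VF : 'End(V))^-1%VF = \1%VF.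
  by apply: GL_cancel => u; rewrite !lfunE.
by apply/lfunP => v; rewrite adjE oneV !id_lfunE.
Qed.

Lemma adj_comp g h I : GL g -> GL h -> adj (g \o h)%VF I = adj g (adj h I).
Proof.
move=> Gg Gh; have [_ ghV] := GL_comp Gg Gh.
by apply/lfunP => v; rewrite !adjE ghV !comp_lfunE.
Qed.

Lemma adjK g I : GL g -> adj g^-1%VF (adj g I) = I.
Proof.
move=> Gg; have [_ gVV] := GL_cancel (GLVK Gg) (GLK Gg).
by apply/lfunP => v; rewrite !adjE gVV !(GLK Gg).
Qed.

Lemma dim_limg_adj g I : GL g -> \dim (limg (adj g I)) = \dim (limg I).
Proof.
have limg_le J h : GL h -> (\dim (limg (adj h J)) <= \dim (limg J))%N.
  move=> Gh; apply: (@leq_trans (\dim (h @: limg J)%VS)).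
    apply: dimvS; apply/subvP => _ /memv_imgP[u _ ->].
    by rewrite adjE !memv_img ?memvf.
  by rewrite -[leqRHS](limg_ker_dim h) leq_addl.
move=> Gg; apply/eqP; rewrite eqn_leq limg_le //=.
by rewrite -{1}[I](adjK I Gg) limg_le //; apply: GL_inv.
Qed.

End GL.

Section RepEquiv.
Variables (R : realType) (V : vectType R) (eps : R).
Implicit Types rho : quat eps -> 'End(V).

Lemma rep_equiv_refl rho : rep_equiv rho rho.
Proof. by exists \1%VF; [exact: GL1 | move=> x; rewrite adj1]. Qed.

Lemma rep_equiv_sym rho rho' : rep_equiv rho rho' -> rep_equiv rho' rho.
Proof.
case=> g Gg rhoE; exists g^-1%VF; first exact: GL_inv.
by move=> x; rewrite rhoE adjK.
Qed.

Lemma rep_equiv_trans rho1 rho2 rho3 :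
  rep_equiv rho1 rho2 -> rep_equiv rho2 rho3 -> rep_equiv rho1 rho3.
Proof.
case=> g Gg rho2E [h Gh rho3E]; exists (h \o g)%VF.
  by have [] := GL_comp Gh Gg.
by move=> x; rewrite adj_comp // -rho2E.
Qed.

Lemma adjoint_orbit_refl (S : set 'End(V)) : adjoint_orbit S S.
Proof.
exists \1%VF; first exact: GL1.
by apply/seteqP; split=> [_ [I SI <-]|I SI]; [|exists I]; rewrite ?adj1.
Qed.

Lemma adjoint_orbit_sub (S S' : set 'End(V)) :
  adjoint_orbit S S' -> adjoint_orbit S' `<=` adjoint_orbit S.
Proof.
case=> g Gg <- _ [h Gh <-]; exists (h \o g)%VF.
  by have [] := GL_comp Gh Gg.
rewrite image_comp; apply: eq_imagel => I _ /=.
by rewrite adj_comp.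
Qed.

Lemma twistor_of_equiv rho rho' :
  rep_equiv rho rho' -> adjoint_orbit (twistor_of rho) (twistor_of rho').
Proof.
case=> g Gg rhoE; exists g => //; rewrite /twistor_of image_comp.
by apply: eq_imagel => x _ /=; rewrite rhoE.
Qed.

End RepEquiv.

(** * Frames: normal forms of H(eps)-modules *)
Section Frames.
Variables (R : realType) (V : vectType R) (eps : R).
Local Notation H := (quat eps).
Implicit Types (rho : H -> 'End(V)) (p q : nat).

(** On the generators [inr b] the element j acts as zero, and only the
   coefficients of 1 and i matter: this is the projection of H(0) onto
   H(0)/H(0)j, a copy of the complex numbers. *)
Definition truncate p q (s : 'I_p + 'I_q) (x : H) : H :=
  if s is inl _ then x else Quat eps (quat_re x) (quat_im x) 0 0.

(** The two equations say that the coordinates identify V with the module of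
   families [x] such that [truncate s (x s) = x s]; linearity and equivariance
   of the coordinates follow from them. *)
Record frame p q rho (e : 'I_p + 'I_q -> V) (xi : 'I_p + 'I_q -> V -> H) :
    Prop := Frame {
  frame_eps : (0 < q)%N -> eps = 0;
  frame_span : forall u, u = \sum_s rho (xi s u) (e s);
  frame_coord : forall x s, xi s (\sum_t rho (x t) (e t)) = truncate s (x s) }.

Section Truncate.
Variables (p q : nat).
Hypothesis q_eps : (0 < q)%N -> eps = 0.
Implicit Type s : 'I_p + 'I_q.

Lemma truncate_linear s : linear (truncate s).
Proof.
by case: s => [//|b] k [????] [????]; congr Quat => /=; rewrite mulr0 addr0.
Qed.

(** For eps = 0 the kernel of the projection is a two-sided ideal. *)
Lemma truncate_mul s x y : truncate s (x * truncate s y) = truncate s (x * y).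
Proof.
case: s => [//|b]; have eps0 : eps = 0 by apply: q_eps; apply: leq_ltn_trans (ltn_ord b).
by case: x y => [????] [????]; congr Quat => /=; rewrite eps0; ring.
Qed.

End Truncate.

Section FrameTheory.
Variables (p q : nat) (rho : H -> 'End(V)).
Variables (e : 'I_p + 'I_q -> V) (xi : 'I_p + 'I_q -> V -> H).
Hypotheses (rep : representation rho) (fr : frame rho e xi).

(** Both sides have the same coordinates. *)
Lemma frame_truncate x :
  \sum_s rho (truncate s (x s)) (e s) = \sum_s rho (x s) (e s).
Proof.
rewrite [RHS](frame_span fr); apply: eq_bigr => s _.
by rewrite (frame_coord fr).
Qed.

Lemma frame_single x s : rho x (e s) = \sum_t rho (if t == s then x else 0) (e t).
Proof.
rewrite (bigD1 s) //= eqxx big1 ?addr0 // => t /negbTE->.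
by rewrite rep0.
Qed.

Lemma frame_coord1 x s t :
  xi t (rho x (e s)) = truncate t (if t == s then x else 0).
Proof. by rewrite frame_single (frame_coord fr). Qed.

Lemma frame_truncate1 x s : rho (truncate s x) (e s) = rho x (e s).
Proof.
rewrite 2!frame_single -[RHS]frame_truncate; apply: eq_bigr => t _.
case: eqP => [->//|_]; congr (rho _ _).
by case: t => //= b; congr Quat.
Qed.

Lemma frame_coord_trunc s u : truncate s (xi s u) = xi s u.
Proof. by rewrite [u in RHS](frame_span fr) (frame_coord fr). Qed.

Lemma frame_coord_linear s : linear (xi s).
Proof.
move=> a u v.
have -> : a *: u + v = \sum_t rho (a *: xi t u + xi t v) (e t).
  rewrite {1}[u](frame_span fr) {1}[v](frame_span fr) scaler_sumr -big_split.
  by apply: eq_bigr => t _; rewrite repDZ.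
by rewrite (frame_coord fr) truncate_linear !frame_coord_trunc.
Qed.

Lemma frame_coord_rep s z u : xi s (rho z u) = truncate s (z * xi s u).
Proof.
rewrite -(frame_coord fr (fun s => z * xi s u)); congr (xi s _).
rewrite {1}[u](frame_span fr) linear_sum; apply: eq_bigr => t _.
by rewrite repM.
Qed.

(** A single free generator suffices to recover x from its action. *)
Lemma frame_faithful : (0 < p)%N -> injective rho.
Proof.
move=> p_gt0 x y rhoxy; pose s : 'I_p + 'I_q := inl (Ordinal p_gt0).
by have := frame_coord1 x s s; rewrite rhoxy frame_coord1 !eqxx.
Qed.

End FrameTheory.

(** What has to be checked on a concrete family; the coordinates are then
   chosen, with the irrelevant coefficients set to zero. *)
Lemma frame_of_generators p q rho (e : 'I_p + 'I_q -> V) :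
    representation rho -> ((0 < q)%N -> eps = 0) ->
    (forall u, exists x, u = \sum_s rho (x s) (e s)) ->
    (forall x, \sum_s rho (x s) (e s) = 0 -> forall s, truncate s (x s) = 0) ->
    (forall b, rho quat_j (e (inr b)) = 0) ->
  exists xi, frame rho e xi.
Proof.
move=> rep q_eps span indep kill.
have killed x s : rho (truncate s x) (e s) = rho x (e s).
  case: s => //= b.
  have eps0 : eps = 0 by apply: q_eps; apply: leq_ltn_trans (ltn_ord b).
  have -> : x = Quat eps (quat_re x) (quat_im x) 0 0
               + Quat eps (quat_jm x) (quat_km x) 0 0 * quat_j.
    by case: x => *; congr Quat => /=; rewrite ?eps0; ring.
  rewrite repD // repM // kill linear0 addr0; congr (rho _ _).
  by case: x => *; congr Quat => /=; rewrite ?eps0; ring.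
have [coord coordE] := choice span.
exists (fun s u => truncate s (coord u s)); split=> // [u|x s].
  rewrite {1}[u]coordE; apply: eq_bigr => s _.
  by rewrite killed.
set u := \sum_t _; apply/eqP; rewrite -subr_eq0; apply/eqP.
rewrite addrC -scaleN1r -truncate_linear scaleN1r addrC.
apply: (indep (fun s => coord u s - x s)).
rewrite (eq_bigr (fun s => rho (coord u s) (e s) - rho (x s) (e s))); last first.
  by move=> t _; rewrite repD // repN.
by rewrite sumrB -coordE subrr.
Qed.

(** Sending each generator to the corresponding one, with the same
   coefficients, is an isomorphism of modules. *)
Lemma frame_rep_equiv p q rho rho' (e e' : 'I_p + 'I_q -> V) xi xi' :
    representation rho -> representation rho' ->
    frame rho e xi -> frame rho' e' xi' ->
  rep_equiv rho rho'.
Proof.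
have morph r r' (f f' : 'I_p + 'I_q -> V) z z' :
    representation r -> representation r' -> frame r f z -> frame r' f' z' ->
  {g : 'End(V) | g =1 fun u => \sum_s r' (z s u) (f' s)}.
  move=> rep rep' fr fr'; apply: lfun_ex => a u v.
  rewrite scaler_sumr -big_split; apply: eq_bigr => s _.
  by rewrite (frame_coord_linear rep fr) (repDZ rep').
move=> rep rep' fr fr'.
have [g gE] := morph _ _ _ _ _ _ rep rep' fr fr'.
have [h hE] := morph _ _ _ _ _ _ rep' rep fr' fr.
have gK : cancel g h.
  move=> u; rewrite hE gE [RHS](frame_span fr); apply: eq_bigr => s _.
  by rewrite (frame_coord fr') (frame_coord_trunc fr).
have hK : cancel h g.
  move=> u; rewrite hE gE [RHS](frame_span fr'); apply: eq_bigr => s _.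
  by rewrite (frame_coord fr) (frame_coord_trunc fr').
have [Gg gV] := GL_cancel gK hK.
exists g => // x; apply/lfunP => u; rewrite adjE gV gE.
have -> : rho' x u = rho' x (g (h u)) by rewrite hK.
rewrite gE linear_sum.
under [RHS]eq_bigr do rewrite (frame_coord_rep rep fr).
rewrite (frame_truncate fr' (fun s => x * xi s (h u))).
by apply: eq_bigr => s _; rewrite repM.
Qed.

(** The model module is the space of pairs of families of quaternions and of
   complex numbers; it is transported to V by a linear isomorphism, which
   exists as soon as the dimensions agree. *)
Lemma frame_ex p q : ((0 < q)%N -> eps = 0) ->
    \dim {:V} = (4 * p + 2 * q)%N ->
  exists rho (e : 'I_p + 'I_q -> V) xi, representation rho /\ frame rho e xi.
Proof.
move=> q_eps dimV.
pose W : vectType R := ({ffun 'I_p -> H} * {ffun 'I_q -> R^o * R^o})%type.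
have dimW : \dim {:W} = \dim {:V}.
  rewrite dimV dimvf -[dim W]/(#|'I_p| * 4 + #|'I_q| * 2)%N !card_ord.
  by rewrite mulnC [(q * _)%N]mulnC.
(* [pack] forgets the coefficients of j and ij on non-free generators, so that
   [syn] turns any family of coefficients into a vector and [xi] reads them
   off. *)
have [phi [psi [phiK psiK]]] := linear_iso_ex dimW.
pose T := ('I_p + 'I_q)%type.
pose xi (s : T) v : H := match s with
  | inl a => (psi v).1 a
  | inr b => Quat eps ((psi v).2 b).1 ((psi v).2 b).2 0 0 end.
pose pack (x : {ffun T -> H}) : W := ([ffun a => x (inl a)],
  [ffun b => ((quat_re (x (inr b)) : R^o), (quat_im (x (inr b)) : R^o))]).
have xi_linear s : linear (xi s).
  move=> a u v; rewrite /xi linearP; case: s => [c|b]; first by rewrite !ffunE.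
  by rewrite !ffunE; congr Quat => /=; rewrite mulr0 addr0.
have xi_trunc s v : truncate s (xi s v) = xi s v by case: s.
have pack_linear : linear pack.
  move=> a x y; congr pair; apply/ffunP => b; rewrite !ffunE //.
  by case: (x (inr b)) (y (inr b)) => [????] [????].
have [syn synE] : {syn : 'Hom({ffun T -> H}, V) | syn =1 fun x => phi (pack x)}.
  by apply: lfun_ex => a x y; rewrite pack_linear linearP.
have xi_syn x s : xi s (syn x) = truncate s (x s).
  by rewrite synE /xi phiK; case: s => b /=; rewrite !ffunE.
have syn_xi v : syn [ffun s => xi s v] = v.
  rewrite synE -[RHS]psiK; congr (phi _).
  rewrite /pack [RHS]surjective_pairing; congr pair; apply/ffunP => b.
    by rewrite !ffunE.
  by rewrite !ffunE /= -surjective_pairing.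
have syn_trunc (x : {ffun T -> H}) : syn [ffun s => truncate s (x s)] = syn x.
  by rewrite -[RHS]syn_xi; congr (syn _); apply/ffunP => s; rewrite !ffunE xi_syn.
have rhoP z : {f : 'End(V) | f =1 fun v => syn [ffun s => z * xi s v]}.
  apply: lfun_ex => a u v; rewrite -linearP; congr (syn _).
  apply/ffunP => s; rewrite !ffunE xi_linear mulrDr.
  by rewrite -quat_scaleAr.
pose rho z := sval (rhoP z); have rhoE z v : rho z v = syn [ffun s => z * xi s v].
  by rewrite /rho; case: (rhoP z) => f fE; rewrite fE.
have rep : representation rho.
  split=> [a x y|| x y]; apply/lfunP => v.
  - rewrite add_lfunE scale_lfunE !rhoE -linearP; congr (syn _).
    by apply/ffunP => s; rewrite !ffunE mulrDl quat_scaleAl.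
  - rewrite id_lfunE rhoE -[RHS]syn_xi; congr (syn _).
    by apply/ffunP => s; rewrite !ffunE mul1r.
  - rewrite comp_lfunE !rhoE -syn_trunc -[RHS]syn_trunc; congr (syn _).
    apply/ffunP => s; rewrite !ffunE xi_syn ffunE.
    by rewrite truncate_mul // mulrA.
pose e s := syn [ffun t => if t == s then 1 else 0].
have comb x : \sum_s rho (x s) (e s) = syn [ffun s => x s].
  transitivity (syn (\sum_s [ffun t => if t == s then x s else 0])).
    rewrite linear_sum; apply: eq_bigr => s _; rewrite rhoE -syn_trunc.
    rewrite -[RHS]syn_trunc; congr (syn _); apply/ffunP => t; rewrite !ffunE.
    rewrite /e xi_syn ffunE truncate_mul //.
    by case: eqP => _; rewrite ?mulr1 ?mulr0.
  congr (syn _); apply/ffunP => t; rewrite sum_ffunE ffunE (bigD1 t) //=.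
  rewrite ffunE eqxx big1 ?addr0 // => s /negbTE st.
  by rewrite ffunE eq_sym st.
exists rho, e, xi; split=> //; split=> // [u|x s].
  by rewrite comb syn_xi.
by rewrite comb xi_syn ffunE.
Qed.

End Frames.

(** The image of j has the complex basis [j e_a], for [e_a] free: j kills the
   other generators, and j (j e_a) = 0. *)
Lemma frame_rank (R : realType) (V : vectType R) (rho : quat (0 : R) -> 'End(V))
    p q (e : 'I_p + 'I_q -> V) xi :
  representation rho -> frame rho e xi -> rep_param rho p.
Proof.
move=> rep fr.
pose A : vectType R := {ffun 'I_p -> R^o * R^o}.
have [F FE] : {F : 'Hom(A, V) | F =1 fun z =>
    \sum_s rho (if s is inl a then Quat 0 0 0 (z a).1 (z a).2 else 0) (e s)}.
  apply: lfun_ex => a z w; rewrite scaler_sumr -big_split.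
  apply: eq_bigr => -[b|b] _ /=; rewrite -(repDZ rep); congr (rho _ _).
    by rewrite !ffunE; congr Quat; rewrite /= mulr0 addr0.
  by rewrite scaler0 addr0.
have F_inj : (fullv :&: lker F = 0)%VS.
  apply/eqP; rewrite capfv -subv0; apply/subvP => z.
  rewrite memv_ker memv0 FE => /eqP z0; apply/eqP/ffunP => a.
  have := frame_coord fr (fun s =>
    if s is inl a then Quat 0 0 0 (z a).1 (z a).2 else 0) (inl a).
  have xi0 : xi (inl a) 0 = 0.
    have := frame_coord_linear rep fr (inl a) (-1) 0 0.
    by rewrite !scaleN1r !addNr.
  by rewrite z0 xi0 ffunE; case: (z a) => b c /= [] <- <-.
rewrite /rep_param; have -> : (2 * p)%N = \dim {:A}.
  by rewrite dimvf -[dim A]/(#|'I_p| * 2)%N card_ord mulnC.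
rewrite -(limg_dim_eq F_inj); congr (\dim _).
apply/eqP; rewrite eqEsubv; apply/andP; split; apply/subvP => _ /memv_imgP[u _ ->].
  have -> : rho quat_j u = F [ffun a => ((quat_re (xi (inl a) u) : R^o),
                                         (- quat_im (xi (inl a) u) : R^o))].
    rewrite FE [LHS](frame_span fr); apply: eq_bigr => s _; congr (rho _ _).
    rewrite (frame_coord_rep rep fr); case: s => [a|b] /=.
      by rewrite ffunE; case: (xi _ u) => * /=; congr Quat; rewrite /=; ring.
    rewrite -(frame_coord_trunc fr).
    by case: (xi _ u) => * /=; congr Quat; rewrite /=; ring.
  by rewrite memv_img ?memvf.
have -> : F u = rho quat_j (\sum_s rho (if s is inl a
    then Quat 0 (u a).1 (- (u a).2) 0 0 else 0) (e s)).
  rewrite FE linear_sum; apply: eq_bigr => s _ /=; rewrite -(repM rep).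
  congr (rho _ _); case: s => [a|b]; last by rewrite mulr0.
  by congr Quat; rewrite /=; ring.
by rewrite memv_img ?memvf.
Qed.

(** * Existence of frames *)
Section FreeFrame.
Variables (R : realType) (V : vectType R) (eps : R) (n : nat).
Variable rho : quat eps -> 'End(V).
Hypotheses (rep : representation rho) (dimV : \dim {:V} = (4 * n)%N).

(** If each proper submodule is missed by some free vector, then V is free.
   The dimension of a free submodule is a multiple of 4, which is all that
   remains of the count of generators in the hypothesis. *)
Lemma free_frame :
    (forall D : {vspace V}, (forall x u, u \in D -> rho x u \in D) ->
       (4 %| \dim D)%N -> D != fullv ->
       exists v, forall x, rho x v \in D -> x = 0) ->
  exists (e : 'I_n + 'I_0 -> V) xi, frame rho e xi.
Proof.
move=> step; have dimH : \dim {: quat eps} = 4%N by rewrite dimvf.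
have dimH_gt0 : (0 < \dim {: quat eps})%N by rewrite dimH.
have stabV x u : u \in {:V}%VS -> rho x u \in {:V}%VS by rewrite !memvf.
have [|q [f [_ free_f span_f]]] :=
    act_greedy (rep_linear rep) dimH_gt0 (sub0v fullv) stabV.
  move=> q f D _ DP _ dD DV; have [x u||v vD] := step D _ _ DV.
  - move=> /DP[d]; rewrite memv0 => /eqP-> [y ->]; rewrite add0r.
    apply/DP; exists 0; rewrite ?mem0v //; exists [ffun b => x * y b].
    rewrite add0r /acomb linear_sum; apply: eq_bigr => b _.
    by rewrite ffunE repM.
  - by rewrite dD dimH dimv0 add0n dvdn_mull.
  - by exists v; rewrite ?memvf.
rewrite dimV dimH dimv0 add0n mulnC => /eqP; rewrite eqn_mul2r /= => /eqP nq.
case: q / nq f free_f span_f => f free_f span_f.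
exists (fun s => if s is inl a then f a else 0).
apply: frame_of_generators => // [u|x|[]//].
  have [d] := span_f u (memvf u); rewrite memv0 => /eqP-> [x ->].
  exists (fun s => if s is inl a then x a else 0).
  by rewrite big_sumType big_ord0 /= addr0 add0r.
rewrite big_sumType big_ord0 /= addr0 => x0 [a|[]//] /=.
have /ffunP/(_ a) : [ffun a => x (inl a)] = 0 :> {ffun 'I_n -> quat eps}.
  apply: free_f; rewrite memv0 -x0; apply/eqP; apply: eq_bigr => b _.
  by rewrite ffunE.
by rewrite !ffunE.
Qed.

End FreeFrame.


Section Classification.
Variables (R : realType) (V : vectType R) (n : nat).

(** If x v lies in a submodule, so does |x|^2 v, and the norm of H(-1) is
   positive definite. *)
Lemma division_frame (rho : quat (-1 : R) -> 'End(V)) :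
    representation rho -> \dim {:V} = (4 * n)%N ->
  exists (e : 'I_n + 'I_0 -> V) xi, frame rho e xi.
Proof.
move=> rep dimV; apply: free_frame => // D stabD _.
rewrite eqEsubv subvf /= => /subvPn[v _ vD]; exists v => x xvD.
have := stabD (quat_conj x) _ xvD.
rewrite -repM // quat_mulJc repZ // rep1 // rpredZeq (negbTE vD) orbF.
rewrite /quat_norm !mulN1r !opprK; case: x {xvD} => a b c d /= /eqP nx0.
by congr Quat; nra.
Qed.

(** The space [Vp] of vectors fixed by j generates V, since u is the sum of
   its two eigencomponents under j and i exchanges the eigenspaces.  Hence a
   submodule containing [Vp] is everything.  One first finds [f1] in [Vp]
   outside the submodule D, then [f2] in [Vp] outside D + <f1, i f1>: the
   latter has dimension at most dim D + 2, hence is proper because dim D and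
   dim V are multiples of 4. *)
Lemma split_frame (rho : quat (1 : R) -> 'End(V)) :
    representation rho -> \dim {:V} = (4 * n)%N ->
  exists (e : 'I_n + 'I_0 -> V) xi, frame rho e xi.
Proof.
move=> rep dimV; apply: free_frame => // D stabD D4 DV.
pose Vp := lker (rho quat_j - \1%VF).
have VpP f : (f \in Vp) = (rho quat_j f == f).
  by rewrite memv_ker add_lfunE opp_lfunE id_lfunE subr_eq0.
have Vp_proper (E : {vspace V}) : (forall u, u \in E -> rho quat_i u \in E) ->
    E != fullv -> exists2 f, f \in Vp & f \notin E.
  move=> stabE; rewrite eqEsubv subvf /= => EV; apply/subvPn.
  apply: contra EV => VpE; apply/subvP => u _.
  have -> : u = 2^-1 *: rho (1 + quat_j) u
              + (- 2^-1) *: rho quat_i (rho (quat_i * (1 - quat_j)) u).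
    rewrite -repM // -!repZ // -repD // -[LHS](rep1 rep); congr (rho _ _).
    by congr Quat; rewrite /=; field.
  apply: memvD; apply: memvZ; last apply: stabE.
    apply: (subvP VpE); rewrite VpP -repM //; apply/eqP; congr (rho _ _).
    by congr Quat; rewrite /=; ring.
  apply: (subvP VpE); rewrite VpP -repM //; apply/eqP; congr (rho _ _).
  by congr Quat; rewrite /=; ring.
have [f1 f1Vp f1D] := Vp_proper D (stabD _) DV.
pose D1 := (D + (<[f1]> + <[rho quat_i f1]>))%VS.
have [f2 f2Vp f2D1] : exists2 f, f \in Vp & f \notin D1.
  apply: Vp_proper => [u|].
    case/memv_addP=> d dD [_ /memv_addP[_ /vlineP[a ->] [_ /vlineP[b ->] ->]] ->].
    rewrite !linearD !linearZ /=; apply: memv_add; first exact: stabD.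
    rewrite addrC; apply: memv_add; last by apply: memvZ; apply: memv_line.
    rewrite -repM // quat_i2 repN // rep1 //.
    by apply: memvZ; rewrite memvN memv_line.
  apply/negP => /eqP D1V.
  have : (\dim {:V} <= \dim D + 2)%N.
    rewrite -D1V; apply: leq_trans (dimv_add_leqif _ _) _.
    rewrite leq_add2l; apply: leq_trans (dimv_add_leqif _ _) _.
    by rewrite !dim_vline; do 2!case: (_ != _).
  have : (\dim D < \dim {:V})%N.
    rewrite ltn_neqAle dimvS ?subvf // andbT.
    by apply: contra DV; rewrite eqEdim subvf /= => /eqP->.
  rewrite dimV; case/dvdnP: D4 => m ->.
  by rewrite mulnC ltn_pmul2l // => mn; lia.
have fixE x f : f \in Vp -> rho x f =
    (quat_re x + quat_jm x) *: f + (quat_im x + quat_km x) *: rho quat_i f.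
  rewrite VpP => /eqP jf; case: x => a b c d /=.
  rewrite quat_basisE !repD // !repZ // rep1 // repM // jf.
  rewrite !scalerDl !addrA; congr (_ + _); apply: addrAC.
(* It suffices to express the coefficients of [x] through combinations of [f1]
   and [f2] that lie in D. *)
have indep a b : a *: f1 + b *: f2 \in D -> a = 0 /\ b = 0.
  move=> abD; have [b0|bn0] := eqVneq b 0; last first.
    case/negP: f2D1.
    have -> : f2 = b^-1 *: (a *: f1 + b *: f2) + (- (b^-1 * a)) *: f1.
      rewrite scalerDr !scalerA mulVf // scale1r scaleNr addrAC addrN add0r //.
    apply: memv_add; first exact: memvZ.
    by rewrite -[_ *: f1]addr0 memv_add ?mem0v // memvZ ?memv_line.
  split=> //; apply/eqP; move: abD; rewrite b0 scale0r addr0 rpredZeq.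
  by rewrite (negbTE f1D) orbF.
exists (f1 + rho quat_i f2) => x xvD.
(* The element 1 + j projects [x (f1 + i f2)] to [Vp]; applied to [x] and to
   [i x], this yields the four equations that make [x] vanish. *)
have coefs a b c d : rho (Quat 1 a b c d) (f1 + rho quat_i f2) \in D ->
    a + c = 0 /\ d - b = 0.
  move/(stabD (1 + quat_j)); rewrite -repM // linearD /= -repM //.
  set y := (1 + quat_j) * _; set z := y * quat_i.
  have y1 : quat_re y + quat_jm y = 2 * (a + c) by rewrite /=; ring.
  have y2 : quat_im y + quat_km y = 0 by rewrite /=; ring.
  have z1 : quat_re z + quat_jm z = 2 * (d - b) by rewrite /=; ring.
  have z2 : quat_im z + quat_km z = 0 by rewrite /=; ring.
  rewrite (fixE y) // (fixE z) // y1 y2 z1 z2 !scale0r !addr0 => /indep[].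
  by move=> ac db; split; lra.
have ixvD := stabD quat_i _ xvD; rewrite -repM // in ixvD.
case: x xvD ixvD => a b c d /coefs[ac db].
have -> : quat_i * Quat 1 a b c d = Quat 1 (- b) a (- d) c.
  by congr Quat; ring.
by move=> /coefs[bd ca]; congr Quat; lra.
Qed.

(** The complex numbers act through the span of 1 and i, and j is antilinear
   for this action.  The greedy construction is applied twice: to the image
   of j, then to its kernel relative to the image. *)
Lemma dual_frame (rho : quat (0 : R) -> 'End(V)) : representation rho ->
  exists p q (e : 'I_p + 'I_q -> V) xi,
    frame rho e xi /\ \dim {:V} = (4 * p + 2 * q)%N.
Proof.
move=> rep; pose A : vectType R := (R^o * R^o)%type.
pose cpx (z : A) : quat (0 : R) := Quat 0 z.1 z.2 0 0.
pose act z := rho (cpx z).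
have dimA : \dim {:A} = 2%N by rewrite dimvf.
have act_linear : linear act.
  move=> a z w; apply/lfunP => u; rewrite add_lfunE scale_lfunE /act -repDZ //.
  by congr (rho _ _); congr Quat; rewrite /= mulr0 addr0.
have jcpx z u : rho quat_j (act z u) = act (z.1, - z.2) (rho quat_j u).
  by rewrite /act -!repM //; congr (rho _ _); congr Quat; rewrite /=; ring.
have jj u : rho quat_j (rho quat_j u) = 0.
  by rewrite -repM // quat_j2 scale0r rep0.
pose im := limg (rho quat_j); pose ker := lker (rho quat_j).
have im_ker : (im <= ker)%VS.
  by apply/subvP => _ /memv_imgP[u _ ->]; rewrite memv_ker jj.
have stab_im z u : u \in im -> act z u \in im.
  case/memv_imgP=> w _ ->; have := jcpx (z.1, - z.2) w.
  by rewrite /= opprK -surjective_pairing => <-; rewrite memv_img ?memvf.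
have stab_ker z u : u \in ker -> act z u \in ker.
  by rewrite !memv_ker jcpx => /eqP->; rewrite linear0.
have greedy (D0 X : {vspace V}) : (D0 <= X)%VS ->
    (forall z u, u \in D0 -> act z u \in D0) ->
    (forall z u, u \in X -> act z u \in X) ->
  exists q (f : 'I_q -> V), [/\ forall b, f b \in X,
    forall x, acomb act f x \in D0 -> x = 0,
    forall u, u \in X -> exists2 d, d \in D0 & exists x, u = d + acomb act f x &
    \dim X = (\dim D0 + q * \dim {:A})%N].
  move=> D0X stab0 stabX; apply: act_greedy => //; first by rewrite dimA.
  move=> q f D fX DP DX _; rewrite eqEsubv DX /= => /subvPn[v vX vD].
  exists v => // z zvD; have : act (z.1, - z.2) (act z v) \in D.
    case/DP: zvD => d dD0 [x ->]; apply/DP; exists (act (z.1, - z.2) d).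
      exact: stab0.
    exists [ffun b => (z.1 * (x b).1 + z.2 * (x b).2, z.1 * (x b).2 - z.2 * (x b).1)].
    rewrite linearD; congr (_ + _); rewrite /acomb linear_sum.
    apply: eq_bigr => b _; rewrite /= /act -repM // ffunE; congr (rho _ _).
    by congr Quat; rewrite /=; ring.
  have -> : act (z.1, - z.2) (act z v) = (z.1 ^+ 2 + z.2 ^+ 2) *: v.
    rewrite /act -repM // -[v in RHS](rep1 rep) -repZ //; congr (rho _ _).
    by congr Quat; rewrite /=; ring.
  rewrite rpredZeq (negbTE vD) orbF paddr_eq0 ?sqr_ge0 // !sqrf_eq0.
  by case: z {zvD} => a b /= /andP[/eqP-> /eqP->].
have stab_0 z u : u \in 0%VS -> act z u \in (0%VS : {vspace V}).
  by rewrite !memv0 => /eqP->; rewrite linear0.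
have [p [f [f_im free_f span_f dim_im]]] :=
  greedy _ _ (sub0v im) stab_0 stab_im.
have [q [f' [f'_ker free_f' span_f' dim_ker]]] :=
  greedy _ _ im_ker stab_im stab_ker.
have f_lift a : exists w, f a = rho quat_j w.
  by have /memv_imgP[w _ ->] := f_im a; exists w.
(* The generators [h a] are free: multiplying a relation by j shows that the
   coefficients of 1 and i vanish, and what is left is a relation among the
   [f a] and [f' b]. *)
have [h hE] := choice f_lift.
pose e (s : 'I_p + 'I_q) := match s with inl a => h a | inr b => f' b end.
have decomp x u : rho x u =
    act (quat_re x, quat_im x) u + act (quat_jm x, quat_km x) (rho quat_j u).
  rewrite /act -repM // -repD //; congr (rho _ _).
  by case: x => *; congr Quat; rewrite /=; ring.
have f'_kill b : rho quat_j (f' b) = 0.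
  by apply/eqP; rewrite -memv_ker.
have comb x : \sum_s rho (x s) (e s) =
    \sum_a act (quat_re (x (inl a)), quat_im (x (inl a))) (h a)
    + acomb act f [ffun a => (quat_jm (x (inl a)), quat_km (x (inl a)))]
    + acomb act f' [ffun b => (quat_re (x (inr b)), quat_im (x (inr b)))].
  rewrite big_sumType /= -big_split /=; congr (_ + _).
    by apply: eq_bigr => a _; rewrite decomp hE ffunE.
  by apply: eq_bigr => b _; rewrite decomp f'_kill linear0 addr0 ffunE.
have j_h (z : 'I_p -> A) : rho quat_j (\sum_a act (z a) (h a))
    = acomb act f [ffun a => ((z a).1, - (z a).2)].
  by rewrite linear_sum; apply: eq_bigr => a _; rewrite ffunE hE -jcpx.
have f_comb_im x : acomb act f x \in im.
  by apply: memv_suml => a _; apply: stab_im.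
have j_f x : rho quat_j (acomb act f x) = 0.
  by apply/eqP; rewrite -memv_ker; apply: (subvP im_ker).
have j_f' x : rho quat_j (acomb act f' x) = 0.
  by apply/eqP; rewrite -memv_ker; apply: memv_suml => b _; apply: stab_ker.
exists p, q, e.
have [//|u|x x0|b|xi fr] := @frame_of_generators _ _ _ p q rho e rep.
- have [d] := span_f (rho quat_j u) (memv_img _ (memvf _)).
  rewrite memv0 => /eqP-> [z]; rewrite add0r => juE.
  pose u' := u - \sum_a act ((z a).1, - (z a).2) (h a).
  have u'ker : u' \in ker.
    rewrite memv_ker linearB /= j_h juE subr_eq0; apply/eqP; congr acomb.
    by apply/ffunP => a; rewrite ffunE /= opprK -surjective_pairing.
  have [d' /span_f[d0 + [z' d'E]] [w u'E]] := span_f' u' u'ker.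
  rewrite memv0 => /eqP d0_0.
  exists (fun s : 'I_p + 'I_q => match s with
    | inl a => Quat 0 (z a).1 (- (z a).2) (z' a).1 (z' a).2
    | inr b => cpx (w b) end).
  rewrite comb -[LHS](subrKC (\sum_a act ((z a).1, - (z a).2) (h a))).
  rewrite -/u' u'E d'E d0_0 add0r addrA; congr (_ + acomb act f _ + acomb act f' _).
    by apply/ffunP => a; rewrite ffunE -surjective_pairing.
  by apply/ffunP => b; rewrite ffunE -surjective_pairing.
- move: x0; rewrite comb => x0.
  have re0 a : quat_re (x (inl a)) = 0 /\ quat_im (x (inl a)) = 0.
    have := congr1 (rho quat_j) x0; rewrite linear0 !linearD /= j_f j_f' !addr0.
    rewrite j_h => /eqP; rewrite -memv0 => /free_f/ffunP/(_ a).
    by rewrite !ffunE => -[-> /eqP]; rewrite oppr_eq0 => /eqP.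
  move: x0; rewrite big1 ?add0r; last first.
    move=> a _; have [-> ->] := re0 a.
    by rewrite /act /cpx -[Quat _ _ _ _ _]/(0 : quat _) rep0.
  move=> x0; have y0 := x0; move/eqP: y0; rewrite addrC addr_eq0 => /eqP y0.
  have/free_f' w0 : acomb act f' [ffun b => (quat_re (x (inr b)), quat_im (x (inr b)))] \in im.
    by rewrite y0 memvN.
  move: x0; rewrite w0 /acomb [X in _ + X]big1 ?addr0; last first.
    by move=> b _; rewrite ffunE /act /cpx -[Quat _ _ _ _ _]/(0 : quat _) rep0.
  move/eqP; rewrite -memv0 => /free_f z0.
  move=> [a|b] /=.
    have [] := re0 a; move/ffunP/(_ a): z0; rewrite !ffunE.
    by case: (x (inl a)) => ? ? ? ? /= [-> ->] -> ->.
  by move/ffunP/(_ b): w0; rewrite !ffunE => -[-> ->].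
- exact: f'_kill.
exists xi; split=> //.
rewrite -(limg_ker_dim (rho quat_j) fullv) capfv dim_ker dim_im dimv0 dimA.
by lia.
Qed.
End Classification.

(** * Bilinear forms *)
Section BilinearForms.
Variables (R : realType) (V : vectType R).
Implicit Types (Om : bilin V) (u v w : V).

Lemma form_val_linearl Om a u v w :
  form_val Om (a *: u + v) w = a * form_val Om u w + form_val Om v w.
Proof. by rewrite /form_val linearP add_lfunE scale_lfunE. Qed.

Lemma form_val_linearr Om a u v w :
  form_val Om w (a *: u + v) = a * form_val Om w u + form_val Om w v.
Proof. by rewrite /form_val linearP. Qed.

Lemma form_valDZ a Om Om' u v :
  form_val (a *: Om + Om') u v = a * form_val Om u v + form_val Om' u v.
Proof. by rewrite /form_val !(add_lfunE, scale_lfunE). Qed.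

Lemma form_valDl Om u v w :
  form_val Om (u + v) w = form_val Om u w + form_val Om v w.
Proof. by rewrite -[u]scale1r form_val_linearl mul1r scale1r. Qed.

Lemma form_valDr Om u v w :
  form_val Om w (u + v) = form_val Om w u + form_val Om w v.
Proof. by rewrite -[u]scale1r form_val_linearr mul1r scale1r. Qed.

Lemma form_val0l Om v : form_val Om 0 v = 0.
Proof. by rewrite /form_val linear0 zero_lfunE. Qed.

Lemma form_val0r Om v : form_val Om v 0 = 0.
Proof. by rewrite /form_val linear0. Qed.

Lemma form_valZl Om a u v : form_val Om (a *: u) v = a * form_val Om u v.
Proof. by rewrite -[a *: u]addr0 form_val_linearl form_val0l addr0. Qed.

Lemma form_valZr Om a u v : form_val Om u (a *: v) = a * form_val Om u v.
Proof. by rewrite -[a *: v]addr0 form_val_linearr form_val0r addr0. Qed.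

Lemma form_valNr Om u v : form_val Om u (- v) = - form_val Om u v.
Proof. by rewrite -scaleN1r form_valZr mulN1r. Qed.

Lemma form_val_suml Om (I : finType) (f : I -> V) v :
  form_val Om (\sum_i f i) v = \sum_i form_val Om (f i) v.
Proof. by elim/big_rec2: _ => [|i a w _ <-]; rewrite ?form_val0l ?form_valDl. Qed.

Lemma form_val_sumr Om (I : finType) (f : I -> V) v :
  form_val Om v (\sum_i f i) = \sum_i form_val Om v (f i).
Proof. by elim/big_rec2: _ => [|i a w _ <-]; rewrite ?form_val0r ?form_valDr. Qed.

Lemma bilin_ext Om Om' : form_val Om =2 form_val Om' -> Om = Om'.
Proof. by move=> OmE; apply/lfunP => u; apply/lfunP => v; apply: OmE. Qed.

Lemma bilin_ex (B : V -> V -> R) :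
    (forall a u v w, B (a *: u + v) w = a * B u w + B v w) ->
    (forall a u v w, B w (a *: u + v) = a * B w u + B w v) ->
  {Om : bilin V | form_val Om =2 B}.
Proof.
move=> Bl Br.
have row u : {f : 'Hom(V, R^o) | f =1 B u}.
  by apply: lfun_ex => a v w; rewrite Br.
have [Om OmE] : {Om : 'Hom(V, 'Hom(V, R^o)) | Om =1 fun u => sval (row u)}.
  apply: lfun_ex => a u v; apply/lfunP => w.
  rewrite add_lfunE scale_lfunE; case: (row _) (row u) (row v) => f fE [g gE] [h hE] /=.
  by rewrite fE gE hE Bl.
by exists Om => u v; rewrite /form_val OmE; case: (row u) => f /= ->.
Qed.

Lemma alternating_skew Om u v :
  Defs.alternating Om -> form_val Om u v = - form_val Om v u.
Proof.
move=> alt; have := alt (u + v).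
rewrite form_valDl !form_valDr !alt add0r addr0 => /eqP.
by rewrite addr_eq0 => /eqP.
Qed.

End BilinearForms.

(** * Imaginary units and Hodge forms *)
Section ImaginaryUnits.
Variables (R : realType) (eps : R).

(** The square of a + v, with v pure, has pure part 2 a v; so a = 0, as real
   numbers have no square root of -1. *)
Lemma imaginary_unitP (x : quat eps) : x * x = -1 <->
  quat_re x = 0 /\
  quat_im x ^+ 2 = 1 + eps * (quat_jm x ^+ 2 + quat_km x ^+ 2).
Proof.
case: x => a b c d /=; split=> [|[-> bE]]; last first.
  by congr Quat => /=; nra.
case=> xa xb xc xd.
have a0 : a = 0.
  apply/eqP; apply: contraTT isT => an0.
  have b0 : b = 0 by apply: (mulfI an0); lra.
  have c0 : c = 0 by apply: (mulfI an0); lra.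
  have d0 : d = 0 by apply: (mulfI an0); lra.
  by move: xa; rewrite b0 c0 d0 => xa; have := sqr_ge0 a; nra.
by split=> //; move: xa; rewrite a0 => xa; lra.
Qed.

Lemma imaginary_unit_conj (x : quat eps) : x * x = -1 -> quat_conj x = - x.
Proof.
by case/imaginary_unitP; case: x => a b c d /= -> _; congr Quat; rewrite oppr0.
Qed.

Lemma imaginary_unit_norm (x : quat eps) : x * x = -1 -> quat_norm x = 1.
Proof.
by case/imaginary_unitP; case: x => a b c d; rewrite /quat_norm /= => -> ->; ring.
Qed.

End ImaginaryUnits.

Section HodgeForms.
Variables (R : realType) (V : vectType R) (eps : R).
Local Notation H := (quat eps).
Variable rho : H -> 'End(V).
Hypotheses (rep : representation rho) (eps_geN1 : -1 <= eps).

Definition conj_adjoint (Om : bilin V) (x : H) := forall u v,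
  form_val Om (rho x u) v = form_val Om u (rho (quat_conj x) v).

(** For an imaginary unit x, invariance under x means that the adjoint of x is
   -x, the conjugate of x.  The elements whose adjoint is their conjugate form
   a subalgebra, and this subalgebra contains i and, since
   sqrt (1 + eps) i + j is an imaginary unit, also j. *)
Lemma HdgP Om : Hdg (twistor_of rho) Om <->
  Defs.alternating Om /\ forall x, conj_adjoint Om x.
Proof.
split=> [[alt inv]|[alt adjn]]; split=> //; last first.
  move=> _ [x xx <-] u v; rewrite adjn -repM // quat_mulJc.
  by rewrite imaginary_unit_norm // scale1r rep1.
have adj_unit x : x * x = -1 -> conj_adjoint Om x.
  move=> xx u v; rewrite imaginary_unit_conj // repN // form_valNr.
  have <- : form_val Om (rho x u) (rho x (rho x v)) = form_val Om u (rho x v).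
    by apply: inv; exists x.
  by rewrite -[rho x (rho x v)]repM // xx repN // rep1 // form_valNr opprK.
have adjDZ a x y : conj_adjoint Om x -> conj_adjoint Om y ->
    conj_adjoint Om (a *: x + y).
  move=> ax ay u v; rewrite quat_conj_linear !repDZ //.
  by rewrite form_val_linearl form_val_linearr ax ay.
have adjM x y : conj_adjoint Om x -> conj_adjoint Om y -> conj_adjoint Om (x * y).
  by move=> ax ay u v; rewrite quat_conjM !repM // ax ay.
have adj_1 : conj_adjoint Om 1.
  move=> u v; have -> : quat_conj 1 = 1 :> H by congr Quat; rewrite oppr0.
  by rewrite !rep1.
have adj_i : conj_adjoint Om quat_i by apply: adj_unit; apply: quat_i2.
have adj_j : conj_adjoint Om quat_j.
  pose b := Num.sqrt (1 + eps); pose x : H := Quat eps 0 b 1 0.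
  have -> : quat_j = (- b) *: quat_i + x.
    by congr Quat; rewrite /=; ring.
  apply: adjDZ => //; apply: adj_unit; apply/imaginary_unitP; split=> //=.
  by rewrite sqr_sqrtr -?lerBlDl ?sub0r //; ring.
move=> [a b c d]; rewrite quat_basisE.
have -> : a%:A + b *: quat_i + c *: quat_j + d *: (quat_i * quat_j) =
    d *: (quat_i * quat_j) + (c *: quat_j + (b *: quat_i + (a *: 1 + 0))) :> H.
  by rewrite addr0 addrC; congr (_ + _); rewrite addrC; congr (_ + _); rewrite addrC.
apply: (adjDZ); first exact: adjM.
do 3![apply: (adjDZ) => //].
move=> u v; rewrite rep0 // form_val0l.
have -> : quat_conj 0 = 0 :> H by congr Quat; rewrite oppr0.
by rewrite rep0 // form_val0r.
Qed.

Variables (p q : nat) (e : 'I_p + 'I_q -> V) (xi : 'I_p + 'I_q -> V -> H).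
Hypothesis fr : frame rho e xi.
Local Notation T := ('I_p + 'I_q)%type.

(** The square matrix stands for the skew and the symmetric matrix obtained as
   its difference and sum with its transpose.  The other matrix, of size p,
   and the vector encode two symmetric matrices: one sits above and on the
   diagonal, the other below the diagonal and in the vector. *)
Definition hodge_data : vectType R :=
  ({ffun T * T -> R^o} *
     ({ffun 'I_p * 'I_p -> R^o} * {ffun 'I_p -> R^o}))%type.
Implicit Type w : hodge_data.

Lemma dim_hodge_data :
  \dim {: hodge_data} = ((p + q) ^ 2 + p * (p + 1))%N.
Proof.
rewrite dimvf -[dim _]/(#|{: T * T}| * 1 + (#|{: 'I_p * 'I_p}| * 1 + #|'I_p| * 1))%N.
by rewrite !card_prod card_sum !card_ord; lia.
Qed.

Definition coef_j w (s t : T) : R := match s, t with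
  | inl a, inl b => if (a <= b)%N then w.2.1 (a, b) else w.2.1 (b, a)
  | _, _ => 0 end.

Definition coef_k w (s t : T) : R := match s, t with
  | inl a, inl b => if (a < b)%N then w.2.1 (b, a)
                    else if (b < a)%N then w.2.1 (a, b) else w.2.2 a
  | _, _ => 0 end.

(** The prescribed value of the form at [(e_s, z e_t)]. *)
Definition gen_form w (s t : T) (z : H) : R :=
  quat_re z * (w.1 (s, t) - w.1 (t, s)) + quat_im z * (w.1 (s, t) + w.1 (t, s))
  + quat_jm z * coef_j w s t + quat_km z * coef_k w s t.

Lemma coef_jC w s t : coef_j w s t = coef_j w t s.
Proof.
case: s t => a [b|b] //=; case: (ltngtP a b) => // ab; last first.
by have -> : a = b by apply: val_inj.
Qed.

Lemma coef_kC w s t : coef_k w s t = coef_k w t s.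
Proof.
case: s t => a [b|b] //=; case: (ltngtP a b) => // ab.
by have -> : a = b by apply: val_inj.
Qed.

(** The symmetries of the four matrices, in a single equation: conjugation
   fixes 1 and changes the sign of i, j and ij. *)
Lemma gen_formC w s t z : gen_form w s t (quat_conj z) = - gen_form w t s z.
Proof.
by rewrite /gen_form (coef_jC w t s) (coef_kC w t s); case: z => * /=; ring.
Qed.

Lemma gen_form_linear w s t a z z' :
  gen_form w s t (a *: z + z') = a * gen_form w s t z + gen_form w s t z'.
Proof. by case: z z' => ? ? ? ? [? ? ? ?]; rewrite /gen_form /=; ring. Qed.

Lemma gen_form_data_linear a w w' s t z :
  gen_form (a *: w + w') s t z = a * gen_form w s t z + gen_form w' s t z.
Proof.
have jE : coef_j (a *: w + w') s t = a * coef_j w s t + coef_j w' s t.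
  case: s t => b [c|c] /=; rewrite ?mulr0 ?addr0 //.
  by case: ifP => _; rewrite !ffunE.
have kE : coef_k (a *: w + w') s t = a * coef_k w s t + coef_k w' s t.
  case: s t {jE} => b [c|c] /=; rewrite ?mulr0 ?addr0 //.
  by do 2?[case: ifP => _]; rewrite !ffunE.
rewrite /gen_form jE kE !ffunE /=.
have scaleE (y : R^o) : a *: y = a * y by [].
by rewrite !scaleE; ring.
Qed.

(** The values are well defined on coefficients modulo the ideal generated by
   j wherever a non-free generator is involved. *)
Lemma gen_form_truncater w s t x y :
  gen_form w s t (x * truncate t y) = gen_form w s t (x * y).
Proof.
have trE z : gen_form w s t (truncate t z) = gen_form w s t z.
  case: t => [//|b]; rewrite /gen_form.
  have -> : coef_j w s (inr b) = 0 by case: s.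
  have -> : coef_k w s (inr b) = 0 by case: s.
  by rewrite /= !mulr0.
by rewrite -trE (truncate_mul (frame_eps fr)) trE.
Qed.

Lemma gen_form_truncatel w s t x y :
  gen_form w s t (quat_conj (truncate s x) * y) =
  gen_form w s t (quat_conj x * y).
Proof.
have conjE z : quat_conj z * y = quat_conj (quat_conj y * z).
  by rewrite quat_conjM quat_conjK.
by rewrite !conjE !gen_formC gen_form_truncater.
Qed.

(** The value at [(x e_s, y e_t)] is that at [(e_s, (conj x) y e_t)]. *)
Definition hodge_val w (u v : V) : R :=
  \sum_s \sum_t gen_form w s t (quat_conj (xi s u) * xi t v).

Fact hodge_bilin w : {Om : bilin V | form_val Om =2 hodge_val w}.
Proof.
apply: bilin_ex => a u v v'; rewrite /hodge_val mulr_sumr -big_split;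
  apply: eq_bigr => s _; rewrite mulr_sumr -big_split; apply: eq_bigr => t _ /=.
  rewrite (frame_coord_linear rep fr) quat_conj_linear mulrDl -quat_scaleAl.
  by rewrite gen_form_linear.
by rewrite (frame_coord_linear rep fr) mulrDr -quat_scaleAr gen_form_linear.
Qed.

Definition hodge_form w : bilin V := sval (hodge_bilin w).

Lemma hodge_formE w u v : form_val (hodge_form w) u v = hodge_val w u v.
Proof. by rewrite /hodge_form; case: (hodge_bilin w) => Om /= ->. Qed.

Lemma hodge_form_linear : linear hodge_form.
Proof.
move=> a w w'; apply: bilin_ext => u v; rewrite form_valDZ !hodge_formE.
rewrite /hodge_val mulr_sumr -big_split; apply: eq_bigr => s _.
rewrite mulr_sumr -big_split; apply: eq_bigr => t _.
by rewrite gen_form_data_linear.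
Qed.

Lemma hodge_form_Hdg w : Hdg (twistor_of rho) (hodge_form w).
Proof.
apply/HdgP; split=> [u|x u v]; rewrite !hodge_formE /hodge_val.
  set S := \sum_s _; suff : S = - S by move=> ?; lra.
  rewrite {1}/S exchange_big -sumrN; apply: eq_bigr => s _.
  rewrite -sumrN; apply: eq_bigr => t _.
  by rewrite -gen_formC quat_conjM quat_conjK.
apply: eq_bigr => s _; apply: eq_bigr => t _.
rewrite !(frame_coord_rep rep fr) gen_form_truncater gen_form_truncatel.
by rewrite quat_conjM mulrA.
Qed.

Lemma hodge_form_gen w s t z :
  form_val (hodge_form w) (e s) (rho z (e t)) = gen_form w s t z.
Proof.
have xi_e s' : xi s' (e s) = if s' == s then 1 else 0.
  rewrite -[e s](rep1 rep) (frame_coord1 rep fr).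
  by case: s' => // b; case: ifP.
have gen0 s' t' : gen_form w s' t' 0 = 0.
  by rewrite /gen_form /= !mul0r !addr0.
rewrite hodge_formE /hodge_val (bigD1 s) //= [X in _ + X]big1 ?addr0.
  rewrite (bigD1 t) //= [X in _ + X]big1 ?addr0.
    rewrite (frame_coord1 rep fr) eqxx xi_e eqxx gen_form_truncater.
    have -> : quat_conj 1 = 1 :> H by congr Quat; rewrite oppr0.
    by rewrite mul1r.
  move=> t' /negbTE t't; rewrite (frame_coord1 rep fr) t't.
  by rewrite gen_form_truncater mulr0 gen0.
move=> s' /negbTE s's; rewrite big1 // => t' _; rewrite xi_e s's.
have -> : quat_conj 0 = 0 :> H by congr Quat; rewrite oppr0.
by rewrite mul0r gen0.
Qed.

Lemma hodge_form_inj : injective hodge_form.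
Proof.
move=> w w' ww'.
have genE s t z : gen_form w s t z = gen_form w' s t z.
  by rewrite -!hodge_form_gen ww'.
have jE s t : coef_j w s t = coef_j w' s t.
  by have := genE s t quat_j; rewrite /gen_form /= !mul0r !mul1r !add0r !addr0.
have kE s t : coef_k w s t = coef_k w' s t.
  have := genE s t (Quat eps 0 0 0 1).
  by rewrite /gen_form /= !mul0r !mul1r !add0r.
case: w w' {ww'} genE jE kE => B [C r] [B' [C' r']] genE jE kE.
congr (_, (_, _)); apply/ffunP.
- move=> [s t]; have := genE s t 1; have := genE s t quat_i.
  by rewrite /gen_form /= !mul0r !mul1r !add0r !addr0 => ? ?; lra.
- move=> [a b]; have [ab|ba] := leqP a b.
    by have := jE (inl a) (inl b); rewrite /= ab.
  by have := kE (inl b) (inl a); rewrite /= ba.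
- by move=> a; have := kE (inl a) (inl a); rewrite /= ltnn.
Qed.

(** The data are recovered from the values of the form on generators; that
   j kills the non-free generators accounts for the vanishing entries. *)
Lemma hodge_form_surj Om :
  Hdg (twistor_of rho) Om -> exists w, Om = hodge_form w.
Proof.
case/HdgP => alt adjn; pose A z s t := form_val Om (e s) (rho z (e t)).
have AC z s t : A z t s = - A (quat_conj z) s t.
  by rewrite /A (alternating_skew _ _ alt) adjn.
have conj1 : quat_conj 1 = 1 :> H by congr Quat; rewrite oppr0.
have conj_i : quat_conj quat_i = - quat_i :> H by congr Quat; rewrite ?oppr0.
have conj_j : quat_conj quat_j = - quat_j :> H by congr Quat; rewrite ?oppr0.
pose k : H := quat_i * quat_j.
have conj_k : quat_conj k = - k by congr Quat; rewrite /=; ring.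
have AN z s t : A (- z) s t = - A z s t by rewrite /A repN // form_valNr.
pose w : hodge_data :=
  ([ffun st => (2^-1 * (A 1 st.1 st.2 + A quat_i st.1 st.2) : R^o)],
   ([ffun ab : 'I_p * 'I_p => (if (ab.1 <= ab.2)%N
       then A quat_j (inl ab.1) (inl ab.2) else A k (inl ab.1) (inl ab.2) : R^o)],
    [ffun a => (A k (inl a) (inl a) : R^o)])).
have kill z (b : 'I_q) : rho (z * quat_j) (e (inr b)) = 0.
  rewrite repM // -(frame_truncate1 rep fr).
  have -> : truncate (inr b : T) quat_j = 0 by [].
  by rewrite rep0 // linear0.
have genA s t z : gen_form w s t z = A z s t.
  have -> : A z s t = quat_re z * A 1 s t + quat_im z * A quat_i s t
      + quat_jm z * A quat_j s t + quat_km z * A k s t.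
    rewrite /A; case: z => a b c d /=; rewrite quat_basisE !repD // !repZ //.
    by rewrite !form_valDr !form_valZr.
  have jE : coef_j w s t = A quat_j s t.
    have zero s' (b : 'I_q) : A quat_j s' (inr b) = 0.
      by rewrite /A -[quat_j]mul1r kill form_val0r.
    case: s t => [a|a] [b|b] /=; rewrite ?zero //; last first.
      by rewrite AC conj_j AN zero !oppr0.
    rewrite !ffunE /=; case: (ltngtP a b) => // ab.
    by rewrite AC conj_j AN opprK.
  have kE : coef_k w s t = A k s t.
    clear jE; have zero s' (b : 'I_q) : A k s' (inr b) = 0.
      by rewrite /A kill form_val0r.
    case: s t => [a|a] [b|b] /=; rewrite ?zero //; last first.
      by rewrite AC conj_k AN zero !oppr0.
    rewrite !ffunE /=; case: (ltngtP a b) => //= ab.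
      by rewrite AC conj_k AN opprK.
    by have -> : a = b by apply: val_inj.
  rewrite /gen_form jE kE !ffunE /= (AC 1 s t) (AC quat_i s t).
  by rewrite conj1 conj_i AN; lra.
exists w; apply: bilin_ext => u v; rewrite hodge_formE /hodge_val.
rewrite {1}[u](frame_span fr) {1}[v](frame_span fr) form_val_suml.
apply: eq_bigr => s _; rewrite form_val_sumr; apply: eq_bigr => t _.
by rewrite adjn -repM // genA.
Qed.

Lemma frame_has_dim_Hdg :
  has_dim (Hdg (twistor_of rho)) ((p + q) ^ 2 + p * (p + 1)).
Proof.
rewrite -dim_hodge_data.
apply: (has_dim_param hodge_form_linear hodge_form_inj).
apply/seteqP; split=> [Om /hodge_form_surj[w ->]|_ [w _ <-]]; first by exists w.
exact: hodge_form_Hdg.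
Qed.

End HodgeForms.

(** * Twistor lines without Kaehler classes *)
Section NoKahler.
Variables (R : realType) (V : vectType R).

(** With respect to a pure quaternion x, the sum of Om(v, x v) over
   v = u, i u, j u, k u equals Om(u, (x - i x i - j x j - k x k) u), which
   vanishes. *)
Lemma division_no_kahler (rho : quat (-1 : R) -> 'End(V)) :
    representation rho -> (exists u : V, u != 0) ->
  no_kahler (twistor_of rho).
Proof.
move=> rep [u un0] Om _ /(HdgP rep (lexx _))[_ adjn] [x xx <-] [_ _ _ pos].
have unit_pos y : y * y = -1 :> quat (-1 : R) ->
    0 < form_val Om u (rho (- (y * x * y)) u).
  move=> yy; have yun0 : rho y u != 0.
    apply: contraNneq un0 => yu0; rewrite -[u]opprK oppr_eq0.
    by rewrite -[u in - u](rep1 rep) -repN // -yy repM // yu0 linear0.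
  have := pos _ yun0; rewrite adjn imaginary_unit_conj // -!repM //.
  by rewrite !mulNr.
have [x0 _] := (imaginary_unitP x).1 xx.
pose k : quat (-1 : R) := quat_i * quat_j.
have kk : k * k = -1 by congr Quat; rewrite /=; ring.
have jj : quat_j * quat_j = -1 :> quat (-1 : R) by congr Quat; rewrite /=; ring.
have := addr_gt0 (pos u un0) (addr_gt0 (unit_pos _ (quat_i2 _))
          (addr_gt0 (unit_pos _ jj) (unit_pos _ kk))).
rewrite -!form_valDr -!repD //.
have -> : x + (- (quat_i * x * quat_i) + (- (quat_j * x * quat_j)
            + - (k * x * k))) = 0.
  by case: x x0 {xx pos unit_pos} => a b c d /= ->; congr Quat; rewrite /=; ring.
by rewrite rep0 // form_val0r ltxx.
Qed.

(** On the image of j, which is nonzero for a faithful representation, one has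
   Om(j u, x j u) = - Om(u, j x j u), and j x j = 0 for pure x. *)
Lemma dual_no_kahler (rho : quat (0 : R) -> 'End(V)) :
  faithful_representation rho -> no_kahler (twistor_of rho).
Proof.
case=> rep inj Om _ /(HdgP rep (lerN10 _))[_ adjn] [x xx <-] [_ _ _ pos].
have [u jun0] : exists u, rho quat_j u != 0.
  apply: contrapT => j0; have : quat_j = 0 :> quat (0 : R).
    apply: inj; apply/lfunP => u; rewrite rep0 //; apply/eqP.
    by apply: contraT => jun0; case: j0; exists u.
  by case=> /eqP; rewrite oner_eq0.
have [x0 _] := (imaginary_unitP x).1 xx.
have := pos _ jun0; rewrite adjn -!repM //.
have -> : quat_conj quat_j * x * quat_j = 0.
  by case: x x0 {xx pos} => a b c d /= ->; congr Quat; rewrite /=; ring.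
by rewrite rep0 // form_val0r ltxx.
Qed.

End NoKahler.

(** * Connected components of twistor lines *)
Section VectorTopologyTheory.
Variables (R : realType) (W : vectType R).
Import VectorInternalTheory.

Lemma linear_continuous_vtop (f : W -> R) :
  (forall a u v, f (a *: u + v) = a * f u + f v) -> continuous (f : vtop W -> R).
Proof.
move=> f_lin; have [F FE] : {F : 'Hom(W, R^o) | F =1 f} by apply: lfun_ex.
pose g (x : 'rV[R]_(dim W)) : R := \sum_i x 0 i * f (r2v (delta_mx 0 i)).
have -> : f = g \o v2r.
  apply/funext => u; rewrite /g /= -FE -{1}[u]v2rK [in LHS](row_sum_delta (v2r u)).
  rewrite !linear_sum; apply: eq_bigr => i _; rewrite !linearZ /=.
  by rewrite FE.
have g_cont : continuous g.
  apply: continuous_big.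
    exact: add_continuous.
  move=> i _ x; apply: (@continuousM _ _ (fun y : 'rV[R]_(dim W) => y 0 i)).
    exact: coord_continuous.
  exact: cst_continuous.
by move=> u; apply: continuous_comp; [exact: initial_continuous | exact: g_cont].
Qed.

Lemma curve_continuous_vtop (f g : R -> R) (A B : W) :
  continuous f -> continuous g ->
  continuous (fun t => f t *: A + g t *: B : vtop W).
Proof.
move=> f_cont g_cont; apply: continuous_comp_initial.
have -> : v2r \o (fun t => f t *: A + g t *: B) =
    fun t => f t *: v2r A + g t *: v2r B.
  by apply/funext => t /=; rewrite linearD !linearZ.
move=> t; apply: cvgD; apply: cvgZr_tmp; [exact: f_cont | exact: g_cont].
Qed.

End VectorTopologyTheory.

Section Sheets.
Variables (R : realType) (V : vectType R) (eps : R).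
Variable rho : quat eps -> 'End(V).
Hypotheses (rep : representation rho) (eps_ge0 : 0 <= eps).

(** The two sheets are obtained for [sg] equal to 1 and to -1. *)
Definition sheet (sg : R) : set 'End(V) :=
  [set rho x | x in [set x | x * x = -1 /\ 0 < sg * quat_im x]].

Lemma imaginary_unit_im (x : quat eps) : x * x = -1 -> 1 <= quat_im x ^+ 2.
Proof.
by case/imaginary_unitP => _ ->; rewrite lerDl mulr_ge0 // addr_ge0 ?sqr_ge0.
Qed.

(** For x = b i + c j + d ij the curve
   sg sqrt (1 + eps (c^2 + d^2) t^2) i + t (c j + d ij) runs through imaginary
   units, from sg i at t = 0 to x at t = 1. *)
Lemma sheet_connected sg A : sg ^+ 2 = 1 -> sheet sg A ->
  connected_component (twistor_of rho : set (vtop 'End(V))) (sg *: rho quat_i) A.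
Proof.
move=> sg2 [x [xx x_pos] <-]; have [x0 imE] := (imaginary_unitP x).1 xx.
pose m := quat_jm x ^+ 2 + quat_km x ^+ 2.
pose f t := sg * Num.sqrt (1 + eps * m * t ^+ 2).
pose curve t := f t *: rho quat_i + t *: rho (Quat eps 0 0 (quat_jm x) (quat_km x)).
have rad_ge0 t : 0 <= 1 + eps * m * t ^+ 2.
  apply: addr_ge0 => //; apply: mulr_ge0; last exact: sqr_ge0.
  by apply: mulr_ge0 => //; apply: addr_ge0; apply: sqr_ge0.
have f2 t : f t ^+ 2 = 1 + eps * m * t ^+ 2.
  by rewrite exprMn sg2 mul1r sqr_sqrtr.
have f_cont : continuous f.
  have rad_cont : continuous (fun t : R => 1 + eps * m * t ^+ 2 : R).
    move=> t; apply: (@continuousD _ _ _ (fun=> 1 : R) (fun t : R => eps * m * t ^+ 2 : R)).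
      exact: cst_continuous.
    apply: (@continuousM _ _ (fun=> eps * m) (fun t : R => t ^+ 2)).
      exact: cst_continuous.
    exact: exprn_continuous.
  move=> t; apply: (@continuousM _ _ (fun=> sg)
      (fun t : R => Num.sqrt (1 + eps * m * t ^+ 2))).
    exact: cst_continuous.
  by apply: continuous_comp; [exact: rad_cont | exact: sqrt_continuous].
have curve_cont : continuous (curve : R -> vtop 'End(V)).
  by apply: curve_continuous_vtop => // t; exact: cvg_id.
have curveE t : curve t = rho (Quat eps 0 (f t) (t * quat_jm x) (t * quat_km x)).
  apply/lfunP => u; rewrite add_lfunE !scale_lfunE -!repZ // -repD //.
  by congr (rho _ _); congr Quat; rewrite /=; ring.
have f1 : f 1 = quat_im x.
  have fx : f 1 ^+ 2 = quat_im x ^+ 2 by rewrite f2 imE /m; ring.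
  have f1_ge0 : 0 <= sg * f 1 by rewrite mulrA -expr2 sg2 mul1r sqrtr_ge0.
  have sfx : (sg * f 1) ^+ 2 = (sg * quat_im x) ^+ 2 by rewrite exprMn fx -exprMn.
  have sfE : sg * f 1 = sg * quat_im x.
    by apply/eqP; rewrite -(@eqrXn2 _ 2) ?(ltW x_pos) // sfx.
  by apply: (mulfI _ sfE); rewrite -sqrf_eq0 sg2 oner_eq0.
have : connected (range (curve : R -> vtop 'End(V))).
  apply: connected_continuous_connected; first by apply/connected_intervalP.
  exact: continuous_subspaceT.
move/(connected_component_max _ _); apply.
- exists 0 => //; rewrite /curve scale0r addr0 /f expr0n /= mulr0 addr0 sqrtr1.
  by rewrite mulr1.
- move=> _ [t _ <-]; rewrite curveE.
  exists (Quat eps 0 (f t) (t * quat_jm x) (t * quat_km x)) => //.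
  by apply/imaginary_unitP; split=> //=; rewrite f2 /m; ring.
- exists 1 => //; rewrite curveE f1 !mul1r; congr (rho _).
  rewrite -x0; by case: (x).
Qed.

(* Such a function separates the two sheets; a frame provides one. *)
Variable im_coord : 'End(V) -> R.
Hypotheses
  (im_coord_linear : forall a A B, im_coord (a *: A + B) = a * im_coord A + im_coord B)
  (im_coordE : forall x, im_coord (rho x) = quat_im x).

(** The square of the coordinate of i is at least 1 on the twistor line, so
   this coordinate keeps its sign on any connected part. *)
Lemma sheet_component sg A : sg ^+ 2 = 1 -> sheet sg A ->
  connected_component (twistor_of rho : set (vtop 'End(V))) A = sheet sg.
Proof.
move=> sg2 sgA; apply/seteqP; split=> B; last first.
  move=> /(sheet_connected sg2); apply: connected_component_trans.
  by apply: connected_component_sym; apply: sheet_connected.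
move=> AB; have [x xx xB] := connected_component_sub AB; exists x => //.
split=> //; rewrite ltNge; apply/negP => x_le0.
pose C := connected_component (twistor_of rho : set (vtop 'End(V))) A.
have : connected ((im_coord : vtop 'End(V) -> R) @` C).
  apply: connected_continuous_connected; first exact: component_connected.
  by apply: continuous_subspaceT; apply: linear_continuous_vtop.
move/connected_intervalP => itv_C; have [y [yy y_pos] yA] := sgA.
have CA : C A by apply: connected_component_refl; exists y.
have imA : (im_coord @` C) (quat_im y) by exists A => //; rewrite -yA im_coordE.
have imB : (im_coord @` C) (quat_im x) by exists B => //; rewrite -xB im_coordE.
have [D CD D0] : (im_coord @` C) 0.
  have /orP[/eqP sg1|/eqP sg1] : (sg == 1) || (sg == -1) by rewrite -sqrf_eq1 sg2.
    by apply: (itv_C _ _ imB imA); move: x_le0 y_pos; rewrite sg1 !mul1r => -> /ltW->.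
  apply: (itv_C _ _ imA imB); move: x_le0 y_pos; rewrite sg1 !mulN1r.
  by rewrite oppr_le0 oppr_gt0 => -> /ltW->.
have [z zz zD] := connected_component_sub CD.
have := imaginary_unit_im zz; rewrite -(im_coordE z) zD D0 expr0n /=.
by rewrite ler10.
Qed.

Lemma sheet_center sg : sg ^+ 2 = 1 -> sheet sg (sg *: rho quat_i).
Proof.
move=> sg2; exists (sg *: quat_i).
  split; last by rewrite /= mulr1 -expr2 sg2.
  by apply/imaginary_unitP; rewrite /= mulr0 !mulr1 sg2 expr0n /=; split; ring.
by apply/lfunP => u; rewrite repZ // scale_lfunE.
Qed.

Lemma components_twistor :
  sheet 1 <> sheet (-1) /\
  components (twistor_of rho) = [set sheet 1; sheet (-1)].
Proof.
have one2 : 1 ^+ 2 = 1 :> R by rewrite expr1n.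
have mone2 : (-1) ^+ 2 = 1 :> R by rewrite sqrrN expr1n.
split=> [eq_sheets|].
  have [x [_ x_pos] /(congr1 im_coord)] : sheet (-1) (1 *: rho quat_i).
    by rewrite -eq_sheets; apply: sheet_center.
  by rewrite scale1r !im_coordE /= => x1; move: x_pos; rewrite x1 mulr1 oppr_gt0 ltr10.
apply/seteqP; split=> [_ [_ [x xx <-] <-]|_ [->|->]]; last 2 first.
- exists (1 *: rho quat_i).
    by rewrite scale1r; exists quat_i => //; apply: quat_i2.
  by apply: sheet_component => //; apply: sheet_center.
- exists (-1 *: rho quat_i).
    exists (- quat_i); first by rewrite /imaginary_units /= mulrNN quat_i2.
    by apply/lfunP => u; rewrite repN // scaleN1r opp_lfunE.
  by apply: sheet_component => //; apply: sheet_center.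
have [x_pos|x_neg|x0] := ltrgtP 0 (quat_im x).
- left; apply: sheet_component => //; exists x => //.
  by split; rewrite ?mul1r.
- right; apply: sheet_component => //; exists x => //.
  by split; rewrite ?mulN1r ?oppr_gt0.
- by have := imaginary_unit_im xx; rewrite -x0 expr0n ler10.
Qed.

End Sheets.

(** The coordinate of i is read off from the action on a free generator. *)
Lemma frame_components (R : realType) (V : vectType R) (eps : R)
    (rho : quat eps -> 'End(V)) p q (e : 'I_p + 'I_q -> V) xi :
    representation rho -> frame rho e xi -> (0 < p)%N -> 0 <= eps ->
  sheet rho 1 <> sheet rho (-1) /\
  components (twistor_of rho) = [set sheet rho 1; sheet rho (-1)].
Proof.
move=> rep fr p_gt0 eps_ge0; pose s : 'I_p + 'I_q := inl (Ordinal p_gt0).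
apply: (components_twistor rep eps_ge0
  (im_coord := fun A => quat_im (xi s (A (e s))))).
  move=> a A B; rewrite add_lfunE scale_lfunE (frame_coord_linear rep fr).
  by case: (xi _ _) (xi _ _) => [????] [????].
by move=> x; rewrite (frame_coord1 rep fr) eqxx.
Qed.

(** Each off-diagonal term is bounded by
   |x_a x_b G_ab| <= (x_a^2 + x_b^2) |G_ab| / 2; after summation and
   symmetrization the diagonal keeps the positive coefficients [slack a]. *)
Lemma diagonally_dominant_pos (R : realFieldType) (I : finType)
    (G : I -> I -> R) (x : I -> R) :
  (forall a b, G a b = G b a) ->
  (forall a, \sum_(b | b != a) `|G a b| < G a a) ->
  (exists a, x a != 0) -> 0 < \sum_a \sum_b x a * x b * G a b.
Proof.
move=> G_sym dom [a0 xa0].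
pose slack a := G a a - \sum_(b | b != a) `|G a b|.
have slack_gt0 a : 0 < slack a by rewrite subr_gt0.
apply: (@lt_le_trans _ _ (\sum_a x a ^+ 2 * slack a)).
  have pos0 : 0 < x a0 ^+ 2 * slack a0.
    by rewrite pmulr_lgt0 ?slack_gt0 // exprn_even_gt0.
  rewrite (bigD1 a0) //= ltr_wpDr //.
  by apply: sumr_ge0 => a _; rewrite mulr_ge0 ?sqr_ge0 // ltW.
pose off a b := 2^-1 * (x a ^+ 2 + x b ^+ 2) * `|G a b|.
have off_sum : \sum_a \sum_(b | b != a) off a b =
    \sum_a x a ^+ 2 * \sum_(b | b != a) `|G a b|.
  have -> : \sum_a \sum_(b | b != a) off a b =
      2^-1 * (\sum_a \sum_(b | b != a) x a ^+ 2 * `|G a b|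
              + \sum_a \sum_(b | b != a) x b ^+ 2 * `|G a b|).
    rewrite -big_split mulr_sumr; apply: eq_bigr => a _.
    rewrite -big_split mulr_sumr; apply: eq_bigr => b _.
    by rewrite /off /= -mulrDl mulrA.
  have -> : \sum_a \sum_(b | b != a) x b ^+ 2 * `|G a b| =
            \sum_a \sum_(b | b != a) x a ^+ 2 * `|G a b|.
    rewrite (exchange_big_dep xpredT) //=; apply: eq_bigr => a _.
    by apply: eq_big => [b|b _]; rewrite 1?eq_sym // G_sym.
  have half (t : R) : 2^-1 * (t + t) = t by field.
  rewrite half.
  by apply: eq_bigr => a _; rewrite mulr_sumr.
have -> : \sum_a x a ^+ 2 * slack a =
    \sum_a (x a ^+ 2 * G a a - \sum_(b | b != a) off a b).
  rewrite sumrB off_sum -sumrB; apply: eq_bigr => a _.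
  by rewrite /slack mulrBr.
apply: ler_sum => a _; rewrite [leRHS](bigD1 a) //= expr2 lerD2l -sumrN.
apply: ler_sum => b _; rewrite /off.
have := ler_norm (G a b); have := lerNnormlW (lexx `|G a b|).
have := sqr_ge0 (x a + x b); have := sqr_ge0 (x a - x b); have := normr_ge0 (G a b).
by rewrite !expr2 => ? ? ? ? ?; nra.
Qed.

(** * Cones of Kaehler classes for H(1) *)
Section KahlerCone.
Variables (R : realType) (V : vectType R) (n : nat).
Variable rho : quat (1 : R) -> 'End(V).
Variables (e : 'I_n + 'I_0 -> V) (xi : 'I_n + 'I_0 -> V -> quat (1 : R)).
Hypotheses (rep : representation rho) (fr : frame rho e xi).

Let geN1 : -1 <= 1 :> R. Proof. by rewrite (le_trans (lerN10 _)). Qed.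

(** For an imaginary unit y with positive coordinate of i, the element
   z = 1 - y i satisfies y z = z i and has norm 2 + 2 Im y > 0.  Writing
   N(z) u = z w gives N(z) Om(u, y u) = Om(w, i w). *)
Lemma split_sheet_kahler sg Om A : sg ^+ 2 = 1 -> Hdg (twistor_of rho) Om ->
    (forall u, u != 0 -> 0 < sg * form_val Om u (rho quat_i u)) ->
  sheet rho sg A -> kahler A Om.
Proof.
move=> sg2 HOm pos [x [xx x_pos] <-].
have xS : twistor_of rho (rho x) by exists x.
have [alt inv] := HOm; have [_ adjn] := (HdgP rep geN1 Om).1 HOm.
split=> // [||u un0]; [|exact: inv|].
  apply/lfunP => u; rewrite comp_lfunE -repM //.
  by have -> : x * x = -1 by []; rewrite repN // rep1 // opp_lfunE id_lfunE.
pose y := sg *: x; have yy : y * y = -1.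
  by rewrite /y -quat_scaleAl -quat_scaleAr scalerA -expr2 sg2 scale1r.
have xE : x = sg *: y by rewrite scalerA -expr2 sg2 scale1r.
have y_pos : 0 < quat_im y by case: x x_pos {xx xS xE yy} @y.
pose z := 1 - y * quat_i; have yz : y * z = z * quat_i.
  rewrite mulrBr mulr1 mulrA yy mulN1r opprK mulrBl mul1r -mulrA quat_i2.
  by rewrite mulrN1 opprK addrC.
have norm_z : 0 < quat_norm z.
  have [y0 imE] := (imaginary_unitP y).1 yy.
  have -> : quat_norm z = 2 + 2 * quat_im y.
    rewrite /z; move: y0 imE; case: (y) => a b c d /= -> imE.
    transitivity (1 + 2 * b + b ^+ 2 - (c ^+ 2 + d ^+ 2)).
      by rewrite /quat_norm /=; ring.
    by rewrite imE; ring.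
  by rewrite addr_gt0 ?mulr_gt0.
pose w := rho (quat_conj z) u.
have zw : rho z w = quat_norm z *: u.
  by rewrite -repM // quat_mulcJ repZ // rep1.
have wn0 : w != 0.
  apply: contraNneq un0 => w0; move/eqP: zw; rewrite w0 linear0 eq_sym.
  by rewrite scaler_eq0 (gt_eqF norm_z).
rewrite xE repZ // form_valZr -(pmulr_rgt0 _ norm_z) mulrCA -form_valZr.
have -> : quat_norm z *: rho y u = rho z (rho quat_i w).
  by rewrite -repM // -yz repM // zw linearZ.
by rewrite -[z in rho z]quat_conjK -adjn; apply: pos.
Qed.

Definition basis_vec (a : ('I_n + 'I_0) * 'I_4) : V := rho (quat_basis 1 a.2) (e a.1).

Definition gram Om a b := form_val Om (basis_vec a) (rho quat_i (basis_vec b)).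

(** Diagonal dominance is an explicit open condition that forces the quadratic
   form sg Om(u, i u) to be positive definite. *)
Definition dominant sg Om := forall a,
  \sum_(b | b != a) `|gram Om a b| < sg * gram Om a a.

Lemma gram_pos sg Om u : sg ^+ 2 = 1 -> Hdg (twistor_of rho) Om ->
  dominant sg Om -> u != 0 -> 0 < sg * form_val Om u (rho quat_i u).
Proof.
move=> sg2 HOm dom un0; have [alt adjn] := (HdgP rep geN1 Om).1 HOm.
pose x a := quat_coef (xi a.1 u) a.2.
have uE : u = \sum_a x a *: basis_vec a.
  rewrite {1}[u](frame_span fr).
  transitivity (\sum_s \sum_l x (s, l) *: basis_vec (s, l)); last first.
    by rewrite pair_bigA; apply: eq_bigr => -[s l].
  apply: eq_bigr => s _; rewrite {1}[xi s u]quat_coefE rep_sum //.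
  by apply: eq_bigr => l _; rewrite repZ.
have iC v w : form_val Om v (rho quat_i w) = form_val Om w (rho quat_i v).
  rewrite (alternating_skew _ _ alt) adjn imaginary_unit_conj ?quat_i2 //.
  by rewrite repN // form_valNr opprK.
have -> : sg * form_val Om u (rho quat_i u) =
    \sum_a \sum_b x a * x b * (sg * gram Om a b).
  rewrite {1}uE form_val_suml mulr_sumr; apply: eq_bigr => a _.
  rewrite form_valZl uE linear_sum form_val_sumr mulr_sumr mulr_sumr.
  apply: eq_bigr => b _; rewrite linearZ /= form_valZr /gram; ring.
apply: diagonally_dominant_pos => [a b|a|].
- by rewrite /gram iC.
- apply: le_lt_trans (dom a); apply: ler_sum => b _.
  have /orP[/eqP->|/eqP->] : (sg == 1) || (sg == -1) by rewrite -sqrf_eq1 sg2.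
    by rewrite mul1r.
  by rewrite mulN1r normrN.
- apply: contrapT => x0; case/negP: un0; apply/eqP.
  rewrite uE big1 // => a _; have -> : x a = 0; last by rewrite scale0r.
  by apply/eqP; apply: contraT => xa; case: x0; exists a.
Qed.

Definition cone sg : set (bilin V) :=
  [set Om | Hdg (twistor_of rho) Om /\ dominant sg Om].

Lemma cone_open sg : open_cone_in (Hdg (twistor_of rho)) (cone sg).
Proof.
split.
  exists [set Om | dominant sg Om] => //.
  rewrite openE => Om dom; rewrite /interior.
  have near_dom a : \forall Om' \near (Om : vtop (bilin V)),
      \sum_(b | b != a) `|gram Om' a b| < sg * gram Om' a a.
    have gram_cont b : continuous ((fun Om' => gram Om' a b) : vtop (bilin V) -> R).
      apply: linear_continuous_vtop => k Om1 Om2; exact: form_valDZ.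
    have gap_cont : continuous ((fun Om' => sg * gram Om' a a
        - \sum_(b | b != a) `|gram Om' a b|) : vtop (bilin V) -> R).
      move=> Om'; apply: (@continuousB _ _ _ (fun Om' : vtop (bilin V) => sg * gram Om' a a)
          (fun Om' : vtop (bilin V) => \sum_(b | b != a) `|gram Om' a b|)).
        apply: (@continuousM _ _ (fun=> sg) (fun Om' : vtop (bilin V) => gram Om' a a)).
          exact: cst_continuous.
        exact: gram_cont.
      apply: continuous_big; first exact: add_continuous.
      move=> b _ Om1; apply: continuous_comp; first exact: gram_cont.
      exact: norm_continuous.
    have gap_pos : nbhs (sg * gram Om a a - \sum_(b | b != a) `|gram Om a b|)
        [set y | 0 < y].
      by apply: open_nbhs_nbhs; split; [exact: open_gt | rewrite /= subr_gt0].
    have := gap_cont Om _ gap_pos; rewrite nbhs_filterE.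
    apply: (@filterS _ (nbhs (Om : vtop (bilin V)))) => Om' /=.
    by rewrite subr_gt0.
  exact: filter_forall near_dom.
move=> t Om t_gt0 [HOm dom]; split.
  have [alt adjn] := (HdgP rep geN1 Om).1 HOm.
  have valZ u v : form_val (t *: Om) u v = t * form_val Om u v.
    by rewrite -[t *: Om]addr0 form_valDZ /form_val !zero_lfunE addr0.
  apply/(HdgP rep geN1); split=> [u|x u v]; rewrite !valZ ?alt ?mulr0 //.
  by rewrite adjn.
move=> a; have gramZ b : gram (t *: Om) a b = t * gram Om a b.
  by rewrite -[t *: Om]addr0 /gram form_valDZ /form_val !zero_lfunE addr0.
rewrite gramZ mulrCA; under eq_bigr do rewrite gramZ normrM gtr0_norm //.
by rewrite -mulr_sumr ltr_pM2l.
Qed.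

(** The form that takes the value sg Im z at [(e_s, z e_s)] and vanishes on
   pairs of distinct generators has sg times the identity as Gram matrix,
   because Im (conj x i y) is the Euclidean scalar product on H(1). *)
Lemma cone_nonempty sg : sg ^+ 2 = 1 -> cone sg !=set0.
Proof.
move=> sg2.
pose w : hodge_data R n 0 :=
  (* The coefficient of i is the sum of the matrix and its transpose. *)
  ([ffun st => (if st.1 == st.2 then 2^-1 * sg else 0 : R^o)], (0, 0)).
exists (hodge_form rep fr w); split; first exact: hodge_form_Hdg.
have gen_w s t z : gen_form w s t z = (if s == t then sg * quat_im z else 0).
  have j0 : coef_j w s t = 0 by case: s t => i [k|k] //=; rewrite !ffunE if_same.
  have k0 : coef_k w s t = 0 by case: s t {j0} => i [k|k] //=; rewrite !ffunE !if_same.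
  have wC : w.1 (t, s) = w.1 (s, t) by rewrite !ffunE /= eq_sym.
  have -> : gen_form w s t z = (w.1 (s, t) + w.1 (t, s)) * quat_im z.
    by rewrite /gen_form j0 k0 wC subrr !mulr0 !addr0 add0r mulrC.
  rewrite !ffunE /= eq_sym; case: eqP => _; last by rewrite addr0 mul0r.
  by field.
have gramE a b : gram (hodge_form rep fr w) a b = if a == b then sg else 0.
  have [_ adjn] := (HdgP rep geN1 _).1 (hodge_form_Hdg rep geN1 fr w).
  have imE l m : quat_im (quat_conj (quat_basis 1 l) * quat_i * quat_basis 1 m)
      = (l == m)%:R :> R.
    case: l m => [[|[|[|[|//]]]] lt_l4] [[|[|[|[|//]]]] lt_m4];
      rewrite /= ?eqE /=; ring.
  case: a b => s l [t m]; rewrite /gram /basis_vec adjn -!repM //.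
  rewrite hodge_form_gen // gen_w xpair_eqE imE.
  by case: eqP => //= _; case: eqP; rewrite ?mulr1 ?mulr0.
move=> a; rewrite big1 => [|b /negbTE ba]; last by rewrite gramE eq_sym ba normr0.
by rewrite gramE eqxx -expr2 sg2.
Qed.

Lemma split_kahler_cones : (0 < n)%N ->
  [/\ cone 1 `&` cone (-1) = set0,
      kahler_cone (twistor_of rho) (sheet rho 1) (cone 1) &
      kahler_cone (twistor_of rho) (sheet rho (-1)) (cone (-1))].
Proof.
move=> n_gt0; have kahler_cone_sg sg : sg ^+ 2 = 1 ->
    kahler_cone (twistor_of rho) (sheet rho sg) (cone sg).
  move=> sg2; split; [exact: cone_nonempty | exact: cone_open |].
  move=> Om A [HOm dom]; apply: split_sheet_kahler => // u un0.
  exact: gram_pos.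
split; [|by apply: kahler_cone_sg; rewrite expr1n|].
  apply/seteqP; split=> // Om [[_ dom] [_ domN]].
  pose a : ('I_n + 'I_0) * 'I_4 := (inl (Ordinal n_gt0), 0).
  have := dom a; have := domN a; rewrite mulN1r mul1r.
  have := @sumr_ge0 R _ (index_enum _) (fun b => b != a) (fun b => `|gram Om a b|).
  by move=> /(_ (fun _ _ => normr_ge0 _)); lra.
by apply: kahler_cone_sg; rewrite sqrrN expr1n.
Qed.

End KahlerCone.

(** * Counting classes and orbits *)

(** A complete invariant with values between 1 and n counts the classes. *)
Lemma card_image_param (T U : Type) (A : set T) (F : T -> U)
    (par : T -> nat -> Prop) n : (0 < n)%N ->
  (forall x, A x -> exists2 k, (1 <= k <= n)%N & par x k) ->
  (forall k, (1 <= k <= n)%N -> exists2 x, A x & par x k) ->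
  (forall x y k l, A x -> A y -> par x k -> par y l -> (F x = F y <-> k = l)) ->
  [set F x | x in A] #= `I_n.
Proof.
move=> n_gt0 has_par real_par class.
have choose i : exists x, (i < n)%N -> A x /\ par x i.+1.
  have [i_lt|i_ge] := ltnP i n.
    by have [//|x Ax x_par] := real_par i.+1; exists x.
  by have [//|x _ _] := real_par 1%N; exists x.
have [x_ x_P] := boolp.choice choose.
have -> : [set F x | x in A] = (F \o x_) @` `I_n.
  apply/seteqP; split=> [_ [x Ax <-]|_ [i /= i_lt <-]]; last first.
    by have [Ax _] := x_P i i_lt; exists (x_ i).
  have [[//|k] /= k_le x_par] := has_par x Ax.
  exists k => //=; have [Axk xk_par] := x_P k k_le.
  exact/(class _ _ _ _ Axk Ax xk_par x_par).
apply: inj_card_eq => i j; rewrite !inE /= => i_lt j_lt Fij.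
have [Ai i_par] := x_P i i_lt; have [Aj j_par] := x_P j j_lt.
by have /(class _ _ _ _ Ai Aj i_par j_par)[] := Fij.
Qed.

Section Orbits.
Variables (R : realType) (V : vectType R).

Lemma rep_class_eq eps (rho rho' : quat eps -> 'End(V)) :
  representation rho' ->
  (rep_class rho = rep_class rho' <-> rep_equiv rho rho').
Proof.
move=> rep'; split=> [eq_class|eqv].
  have [//] : rep_class rho rho'.
  by rewrite eq_class; split=> //; apply: rep_equiv_refl.
apply/seteqP; split=> rho2 [rep2 eqv2]; split=> //.
  by apply: rep_equiv_trans eqv2; apply: rep_equiv_sym.
exact: rep_equiv_trans eqv eqv2.
Qed.

Lemma adjoint_orbit_sym (S S' : set 'End(V)) :
  adjoint_orbit S S' -> adjoint_orbit S' S.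
Proof.
case=> g Gg <-; exists g^-1%VF; first exact: GL_inv.
rewrite image_comp; apply/seteqP; split=> [_ [I SI <-]|I SI] /=.
  by rewrite adjK.
by exists I; rewrite //= adjK.
Qed.

Lemma adjoint_orbit_eq (S S' : set 'End(V)) :
  adjoint_orbit S = adjoint_orbit S' <-> adjoint_orbit S S'.
Proof.
split=> [->|SS']; first exact: adjoint_orbit_refl.
apply/seteqP; split; apply: adjoint_orbit_sub => //.
exact: adjoint_orbit_sym.
Qed.

Lemma GL_transitive_of_equiv eps :
  (exists rho : quat eps -> 'End(V), faithful_representation rho) ->
  (forall rho rho' : quat eps -> 'End(V), faithful_representation rho ->
     faithful_representation rho' -> rep_equiv rho rho') ->
  GL_transitive_on_twistor_lines V eps.
Proof.
move=> [rho faith] equiv; split; first by exists (twistor_of rho), rho.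
move=> _ _ [r fr ->] [r' fr' ->]; apply: twistor_of_equiv; exact: equiv.
Qed.

Lemma adj_faithful eps g (rho : quat eps -> 'End(V)) : GL g ->
  faithful_representation rho ->
  faithful_representation (fun x => adj g (rho x)).
Proof.
move=> Gg [rep inj]; split; last first.
  by move=> x y /(congr1 (adj g^-1%VF)); rewrite !adjK // => /inj.
split=> [a x y||x y]; apply/lfunP => u.
- by rewrite add_lfunE scale_lfunE !adjE repDZ // linearP.
- by rewrite adjE rep1 // id_lfunE GLVK.
- by rewrite comp_lfunE !adjE GLK // repM.
Qed.

End Orbits.

Section DualReps.
Variables (R : realType) (V : vectType R).
Implicit Types rho : quat (0 : R) -> 'End(V).

Lemma rep_param_inj rho k l : rep_param rho k -> rep_param rho l -> k = l.
Proof. by rewrite /rep_param => -> /eqP; rewrite eqn_mul2l => /eqP. Qed.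

Lemma dim_limg_comp (f g : 'End(V)) :
  (\dim (limg (f \o g)%VF) <= \dim (limg g))%N.
Proof. by rewrite limg_comp -[leqRHS](limg_ker_dim f) leq_addl. Qed.

(** The element rho'(j) is the difference rho(z) of two points of the twistor
   line of rho, where z is pure and z^2 = 0.  Hence z has no component along
   i, so z = (c + d i) j, and the rank of rho(z) is at most that of rho(j). *)
Lemma twistor_rank_le rho rho' : faithful_representation rho ->
    faithful_representation rho' -> twistor_of rho' `<=` twistor_of rho ->
  (\dim (limg (rho' quat_j)) <= \dim (limg (rho quat_j)))%N.
Proof.
move=> [rep inj] [rep' _] sub.
have [x xx rho_x] : twistor_of rho (rho' quat_i).
  by apply: sub; exists quat_i => //; apply: quat_i2.
have [y yy rho_y] : twistor_of rho (rho' (quat_i + quat_j)).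
  apply: sub; exists (quat_i + quat_j) => //; apply/imaginary_unitP; split=> /=; ring.
have rho_z : rho (y - x) = rho' quat_j.
  apply/lfunP => u; rewrite repD // repN // rho_x rho_y repD //.
  by rewrite addrAC subrr add0r.
have zz : (y - x) * (y - x) = 0.
  apply: inj; apply/lfunP => u; rewrite repM // rho_z -repM // quat_j2 scale0r.
  by rewrite !rep0.
have [x0 _] := (imaginary_unitP x).1 xx; have [y0 _] := (imaginary_unitP y).1 yy.
have zE : y - x = Quat 0 (quat_jm (y - x)) (quat_km (y - x)) 0 0 * quat_j.
  case: x y x0 y0 zz {xx yy rho_x rho_y rho_z} => a b c d [a' b' c' d'] /= -> ->.
  move=> /(congr1 (@quat_re _ _)) /= zz.
  have /eqP : (b' - b) ^+ 2 = 0 by rewrite expr2; lra.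
  rewrite sqrf_eq0 => /eqP b0.
  by congr Quat; rewrite /= ?b0; ring.
rewrite -rho_z zE; have [_ _ ->] := rep.
exact: dim_limg_comp.
Qed.

Lemma twistor_param_uniq (S : set 'End(V)) k l :
  twistor_param S k -> twistor_param S l -> k = l.
Proof.
move=> [rho faith [-> rho_k]] [rho' faith' [eqS rho'_l]].
have /eqP : (2 * k)%N == (2 * l)%N; last by lia.
rewrite -rho_k -rho'_l eqn_leq !twistor_rank_le //; rewrite eqS; exact: subset_refl.
Qed.

Variable n : nat.
Hypothesis dimV : \dim {:V} = (4 * n)%N.

(** Faithfulness makes j nonzero, hence k >= 1; the number of generators is
   determined by 4 k + 2 q = 4 n. *)
Lemma dual_param rho : faithful_representation rho -> exists k,
  [/\ (1 <= k <= n)%N, rep_param rho k &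
      exists (e : 'I_k + 'I_(2 * n - 2 * k) -> V) xi, frame rho e xi].
Proof.
case=> rep inj; have [p [q [e [xi [fr dimE]]]]] := dual_frame rep.
have rho_p := frame_rank rep fr.
have p_gt0 : (0 < p)%N.
  rewrite lt0n; apply/eqP => p0.
  have j0 : rho quat_j = 0.
    apply/lfunP => u; apply/eqP; rewrite zero_lfunE -memv0.
    have -> : 0%VS = limg (rho quat_j).
      by apply/esym/eqP; rewrite -dimv_eq0 rho_p p0.
    by rewrite memv_img ?memvf.
  have /inj : rho quat_j = rho 0 by apply/lfunP => u; rewrite j0 rep0 // zero_lfunE.
  by case=> /eqP; rewrite oner_eq0.
have qE : q = (2 * n - 2 * p)%N by lia.
exists p; split=> //; first by lia.
by case: _ / qE in e xi fr *; exists e, xi.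
Qed.

Lemma dual_rep_ex k : (1 <= k <= n)%N ->
  exists2 rho : quat (0 : R) -> 'End(V),
    faithful_representation rho & rep_param rho k.
Proof.
move=> /andP[k_gt0 k_le].
have [||rho [e [xi [rep fr]]]] := @frame_ex R V 0 k (2 * n - 2 * k) => //.
  by rewrite dimV; lia.
exists rho; last exact: frame_rank rep fr.
by split=> //; apply: frame_faithful rep fr k_gt0.
Qed.

Lemma dual_rep_equiv rho rho' k l :
  faithful_representation rho -> faithful_representation rho' ->
  rep_param rho k -> rep_param rho' l -> (rep_equiv rho rho' <-> k = l).
Proof.
move=> faith faith' rho_k rho'_l; split=> [[g Gg rhoE]|kl].
  apply: (@rep_param_inj rho') => //.
  by rewrite /rep_param rhoE dim_limg_adj.
have [p [_ rho_p [e [xi fr]]]] := dual_param faith.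
have [p' [_ rho'_p' [e' [xi' fr']]]] := dual_param faith'.
have pp' : p' = p.
  by rewrite (rep_param_inj rho_p rho_k) (rep_param_inj rho'_p' rho'_l).
case: _ / (esym pp') e' xi' fr' => e' xi' fr'.
by apply: frame_rep_equiv fr fr'; [case: faith | case: faith'].
Qed.

Lemma dual_orbit_eq (S S' : set 'End(V)) k l :
  twistor_param S k -> twistor_param S' l ->
  (adjoint_orbit S = adjoint_orbit S' <-> k = l).
Proof.
move=> S_k S'_l; rewrite adjoint_orbit_eq; split=> [[g Gg S'E]|kl].
  have [rho faith [SE rho_k]] := S_k.
  apply: (@twistor_param_uniq S') => //.
  exists (fun x => adj g (rho x)); first exact: adj_faithful.
  by rewrite /rep_param dim_limg_adj // -S'E SE /twistor_of image_comp.
have [rho faith [-> rho_k]] := S_k; have [rho' faith' [-> rho'_l]] := S'_l.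
by apply: twistor_of_equiv; apply/(dual_rep_equiv faith faith' rho_k rho'_l).
Qed.

End DualReps.

Lemma free_has_dim_Hdg (R : realType) (V : vectType R) (n : nat)
    (eps : R) (rho : quat eps -> 'End(V))
    (e : 'I_n + 'I_0 -> V) xi :
  representation rho -> -1 <= eps -> frame rho e xi ->
  has_dim (Hdg (twistor_of rho)) (2 * n ^ 2 + n)%N.
Proof.
move=> rep eps_ge fr; have := frame_has_dim_Hdg rep eps_ge fr.
suff -> : ((n + 0) ^ 2 + n * (n + 1) = 2 * n ^ 2 + n)%N by [].
by nia.
Qed.

Section FreeReps.
Variables (R : realType) (V : vectType R) (n : nat).
Hypotheses (n_gt0 : (0 < n)%N) (dimV : \dim {:V} = (4 * n)%N).

(** The free module has the right dimension for every eps. *)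
Lemma free_rep_ex (eps : R) :
  exists rho : quat eps -> 'End(V), faithful_representation rho.
Proof.
have [||rho [e [xi [rep fr]]]] := @frame_ex R V eps n 0 => //.
  by rewrite dimV addn0.
by exists rho; split=> //; apply: frame_faithful rep fr n_gt0.
Qed.

End FreeReps.


(** * The classification of twistor lines *)
Theorem theorem1p2 (R : realType) (V : vectType R) (n : nat) (Gamma : set V)
    (hn : (1 <= n)%N) (hV : \dim {:V} = (4 * n)%N) (hGamma : lattice Gamma) :
  (* (1) *)
  [/\ forall S : set 'End(V), twistor_line (-1) S ->
        has_dim (Hdg S) (2 * n ^ 2 + n)%N /\ no_kahler S,
      forall rho rho' : quat (-1 : R) -> 'End(V),
        representation rho -> representation rho' -> rep_equiv rho rho' &
      GL_transitive_on_twistor_lines V (-1)]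
  /\
  (* (2) *)
  [/\ forall S : set 'End(V), twistor_line 1 S ->
        has_dim (Hdg S) (2 * n ^ 2 + n)%N /\
        exists (S1 S2 : set 'End(V)) (C1 C2 : set (bilin V)),
          [/\ S1 <> S2 /\ components S = [set S1; S2],
              C1 `&` C2 = set0,
              kahler_cone S S1 C1 &
              kahler_cone S S2 C2],
      forall rho rho' : quat (1 : R) -> 'End(V),
        faithful_representation rho -> faithful_representation rho' ->
        rep_equiv rho rho' &
      GL_transitive_on_twistor_lines V 1]
  /\
  (* (3) *)
  [/\ [set rep_class rho | rho in
         [set rho : quat (0 : R) -> 'End(V) | faithful_representation rho]]
        #= `I_n,
      [/\ forall rho : quat (0 : R) -> 'End(V), faithful_representation rho ->
            exists2 k : nat, (1 <= k <= n)%N & rep_param rho k,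
          forall k : nat, (1 <= k <= n)%N ->
            exists2 rho : quat (0 : R) -> 'End(V),
              faithful_representation rho & rep_param rho k &
          forall (rho rho' : quat (0 : R) -> 'End(V)) (k k' : nat),
            faithful_representation rho -> faithful_representation rho' ->
            rep_param rho k -> rep_param rho' k' ->
            (rep_equiv rho rho' <-> k = k')],
      [set adjoint_orbit S | S in [set S : set 'End(V) | twistor_line 0 S]]
        #= `I_n &
      forall S : set 'End(V), twistor_line 0 S ->
        [/\ exists! k : nat, twistor_param S k,
            forall k : nat, twistor_param S k ->
              has_dim (Hdg S) (k * (k + 1) + (2 * n - k) ^ 2)%N &
            exists S1 S2 : set 'End(V),
              [/\ S1 <> S2, components S = [set S1; S2] &
                  forall (Om : bilin V) (lam : 'End(V)), Hdg S Om ->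
                    S1 lam \/ S2 lam -> ~ kahler lam Om]]].
Proof.
have [u0 u0n0] : exists u : V, u != 0.
  exists (vpick fullv); rewrite vpick0 -dimv_eq0 hV.
  by rewrite muln_eq0 /= -lt0n.
have geN1 : -1 <= 1 :> R by rewrite (le_trans (lerN10 _)).
split; last split.
- have equiv (rho rho' : quat (-1 : R) -> 'End(V)) :
      representation rho -> representation rho' -> rep_equiv rho rho'.
    move=> rep rep'; have [e [xi fr]] := division_frame rep hV.
    have [e' [xi' fr']] := division_frame rep' hV.
    exact: frame_rep_equiv rep rep' fr fr'.
  split=> [_ [rho [rep inj] ->]|//|]; last first.
    apply: GL_transitive_of_equiv; first exact: (free_rep_ex hn hV).
    by move=> rho rho' [rep _] [rep' _]; apply: equiv.
  have [e [xi fr]] := division_frame rep hV; split.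
    exact: (free_has_dim_Hdg rep (lexx _) fr).
  by apply: division_no_kahler => //; exists u0.
- have equiv (rho rho' : quat (1 : R) -> 'End(V)) :
      faithful_representation rho -> faithful_representation rho' ->
      rep_equiv rho rho'.
    move=> [rep _] [rep' _]; have [e [xi fr]] := split_frame rep hV.
    have [e' [xi' fr']] := split_frame rep' hV.
    exact: frame_rep_equiv rep rep' fr fr'.
  split=> [_ [rho [rep inj] ->]|//|]; last first.
    by apply: GL_transitive_of_equiv equiv; exact: (free_rep_ex hn hV).
  have [e [xi fr]] := split_frame rep hV; split.
    exact: (free_has_dim_Hdg rep geN1 fr).
  have [disj cone1 cone2] := split_kahler_cones rep fr hn.
  exists (sheet rho 1), (sheet rho (-1)), (cone rho e 1), (cone rho e (-1)).
  by split=> //; apply: frame_components rep fr hn _.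
- have has_k (rho : quat (0 : R) -> 'End(V)) : faithful_representation rho ->
      exists2 k, (1 <= k <= n)%N & rep_param rho k.
    by move/(dual_param hV) => [k [k_le rho_k _]]; exists k.
  split.
  + apply: (card_image_param (par := @rep_param R V) hn has_k).
      by move=> k /(dual_rep_ex hV).
    move=> rho rho' k l faith faith' rho_k rho'_l.
    rewrite rep_class_eq; last by case: faith'.
    exact: (dual_rep_equiv hV).
  + split=> [//|k /(dual_rep_ex hV)//|rho rho' k l faith faith' rho_k rho'_l].
    exact: (dual_rep_equiv hV).
  + apply: (card_image_param (par := @twistor_param R V) hn).
    * move=> S [rho faith SE]; have [k k_le rho_k] := has_k rho faith.
      by exists k => //; exists rho.
    * move=> k /(dual_rep_ex hV)[rho faith rho_k].
      by exists (twistor_of rho); exists rho.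
    * by move=> S S' k l _ _; apply: (dual_orbit_eq hV).
  + move=> S [rho faith SE]; have [k k_le rho_k] := has_k rho faith.
    have S_k : twistor_param S k by exists rho.
    split.
    * by exists k; split=> // l; apply: twistor_param_uniq.
    * move=> l [r faith_r [-> r_l]].
      have [l' [l'_le r_l' [e [xi fr]]]] := dual_param hV faith_r.
      rewrite -(rep_param_inj r_l' r_l); have [rep _] := faith_r.
      have := frame_has_dim_Hdg rep (lerN10 _) fr.
      suff -> : ((l' + (2 * n - 2 * l')) ^ 2 + l' * (l' + 1) =
                 l' * (l' + 1) + (2 * n - l') ^ 2)%N by [].
      by rewrite addnC; congr (_ + _ ^ 2)%N; lia.
    * have [l [l_le _ [e [xi fr]]]] := dual_param hV faith; have [rep _] := faith.
      have [|neq comps] := frame_components rep fr _ (lexx 0).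
        by case/andP: l_le.
      exists (sheet rho 1), (sheet rho (-1)); split=> //.
        by rewrite SE.
      move=> Om A; rewrite SE => HOm A_sheet; apply: dual_no_kahler HOm _ => //.
      by case: A_sheet => -[x [xx _] <-]; exists x.
Qed.
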